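(* Let $U\in\mathrm{SpSt}(2n,2k)$ and $\Delta\in\mathrm{Hor}^{\rho,g}_U\mathrm{SpSt}(2n,2k)$. Define $H=(I_{2n}-UU^+)J_{2n}^T\Delta(U^TU)^{-1}J_{2k}$, $$X:=\begin{bmatrix}J_{2n}^THJ_{2k}&-J_{2n}^TUJ_{2k}&-U&H\end{bmatrix}\in\mathbb{R}^{2n\times8k}$$ and $$Y:=\begin{bmatrix}U&H&J_{2n}^THJ_{2k}&J_{2n}^TUJ_{2k}\end{bmatrix}\in\mathbb{R}^{2n\times8k}.$$ Then the lifted symplectic Grassmann geodesic from $U$ in direction $\Delta$ (for the Riemannian metric $g^{\mathrm{SpGr}}$) satisfies $$\mathrm{Exp}^{\mathrm{SpGr}}_U(t\Delta)=X\exp(tY^TX)\begin{bmatrix}0_{4k}\\ -I_{4k}\end{bmatrix}\exp\left(t\begin{bmatrix}0&-H^+H\\ I_{2k}&0\end{bmatrix}\right)\begin{bmatrix}I_{2k}\\ 0\end{bmatrix}.$$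
   Context: Let $k\le n$ be positive integers, $J_{2m}=\begin{bmatrix}0&I_m\\ -I_m&0\end{bmatrix}$, and for a real $2a\times 2b$ matrix $A$ put $A^+:=J_{2b}^TA^TJ_{2a}$. $\mathfrak{sp}(2k,\mathbb{R})=\{\Omega\in\mathbb{R}^{2k\times2k}:\Omega^+=-\Omega\}$. $\mathrm{SpSt}(2n,2k)=\{U\in\mathbb{R}^{2n\times2k}:U^+U=I_{2k}\}$; $\mathrm{SpGr}(2n,2k)=\{P\in\mathbb{R}^{2n\times2n}: P^2=P,\ \mathrm{rank}(P)=2k,\ P^+=P\}$; $\rho:\mathrm{SpSt}(2n,2k)\to\mathrm{SpGr}(2n,2k)$, $\rho(U)=UU^+$. $\mathrm{SpSt}(2n,2k)$ carries the Riemannian metric $$g^{\mathrm{SpSt}}_U(\Delta_1,\Delta_2)=\mathrm{tr}\left(\Delta_1^T\left(I_{2n}-\tfrac12J_{2n}^TU(U^TU)^{-1}U^TJ_{2n}\right)\Delta_2(U^TU)^{-1}\right).$$ The horizontal space $\mathrm{Hor}^{\rho,g}_U\mathrm{SpSt}(2n,2k)$ is the $g^{\mathrm{SpSt}}_U$-orthogonal complement of $\ker\mathrm{d}\rho_U=\{UA:A\in\mathfrak{sp}(2k,\mathbb{R})\}$, i.e. $\{(UH^+-HU^+)^TU: H\in\mathbb{R}^{2n\times2k},\ U^+H=0\}$. The Riemannian metric $g^{\mathrm{SpGr}}$ on $\mathrm{SpGr}(2n,2k)$ is $g^{\mathrm{SpGr}}_{UU^+}(\Gamma_1,\Gamma_2)=g^{\mathrm{SpSt}}_U(\Delta_1,\Delta_2)$,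 where $\Delta_i\in\mathrm{Hor}^{\rho,g}_U\mathrm{SpSt}(2n,2k)$ with $\mathrm{d}\rho_U(\Delta_i)=\Gamma_i$. The lifted symplectic Grassmann geodesic $t\mapsto\mathrm{Exp}^{\mathrm{SpGr}}_U(t\Delta)$ is the horizontal curve in $\mathrm{SpSt}(2n,2k)$ starting at $U$ with initial velocity $\Delta$ whose image under $\rho$ is the $g^{\mathrm{SpGr}}$-geodesic starting at $UU^+$ with initial velocity $\mathrm{d}\rho_U(\Delta)$; explicitly, $\mathrm{Exp}^{\mathrm{SpGr}}_U(t\Delta)=\exp(t(\bar\Omega-\bar\Omega^T))\exp(t\bar\Omega^T)U$ with $\bar\Omega=\Delta(U^TU)^{-1}U^T+J_{2n}U(U^TU)^{-1}\Delta^T\left(I_{2n}-J_{2n}^TU(U^TU)^{-1}U^TJ_{2n}\right)J_{2n}$. $\exp$ is the matrix exponential; $0_m$, $I_m$ are the $m\times m$ zero and identity matrices. *)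

(* Defs.v *)
From HB Require Import structures.
From mathcomp Require Import all_boot all_order all_algebra.
From mathcomp Require Import all_classical all_reals all_analysis.

Set Implicit Arguments.
Unset Strict Implicit.
Unset Printing Implicit Defensive.

Import Order.TTheory GRing.Theory Num.Theory.
Import numFieldNormedType.Exports.

Local Open Scope classical_set_scope.
Local Open Scope ring_scope.

Section MatrixExponential.
Context {R : realType}.

Definition mexp m (A : 'M[R]_m) : 'M[R]_m :=
  limn (series (fun i => (i`!%:R)^-1 *: A ^+ i)).

End MatrixExponential.

(* Geodesics of a Riemannian metric g on a submanifold M of a normed space V:
   smooth curves in M that are critical points of the energy, on every compact
   interval, among smooth variations in M with fixed endpoints.  M is given as a
   subset of V, and g p v w is only meaningful for p in M and v, w tangent to M
   at p. *)
Section Geodesics.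
Context {R : realType} {V : normedModType R}.

Definition smooth (c : R -> V) : Prop :=
  forall m t, derivable (c^`(m))%classic t 1.

(* D i j is the partial derivative of order i in the first and j in the second
   variable. *)
Definition smooth2 (F : R -> R -> V) : Prop :=
  exists D : nat -> nat -> R -> R -> V, D 0 0 = F /\
    forall i j,
      [/\ continuous (fun p : R * R => D i j p.1 p.2),
          forall s t, is_derive s (1 : R) (D i j ^~ t) (D i.+1 j s t)
        & forall s t, is_derive t (1 : R) (D i j s) (D i j.+1 s t)].

Definition energy (g : V -> V -> V -> R) (a b : R) (c : R -> V) : R :=
  2^-1 * \int[lebesgue_measure]_(t in `[a, b]) g (c t) (c^`() t)%classic (c^`() t)%classic.

(* F s is the curve with parameter s.  Smoothness of F on the whole plane is no
   restriction: up to shrinking e, a smooth map on ]-e, e[ x [a, b] extends to the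
   plane with values in V, and only the values on that strip are constrained. *)
Definition variation (M : set V) (c : R -> V) (a b e : R) (F : R -> R -> V)
  : Prop :=
  [/\ smooth2 F,
      forall s t, - e < s < e -> a <= t <= b -> M (F s t),
      forall t, a <= t <= b -> F 0 t = c t
    & forall s, - e < s < e -> F s a = c a /\ F s b = c b].

Definition geodesic (M : set V) (g : V -> V -> V -> R) (c : R -> V) : Prop :=
  [/\ smooth c,
      forall t, M (c t)
    & forall a b e F, a < b -> 0 < e -> variation M c a b e F ->
        is_derive (0 : R) (1 : R) (fun s => energy g a b (F s)) 0].

End Geodesics.

Section Symplectic.
Context {R : realType}.

Definition Jmx m : 'M[R]_(m + m) := block_mx 0 1%:M (- 1%:M) 0.

(* The symplectic adjoint A^+. *)
Definition sadj a b (A : 'M[R]_(a + a, b + b)) : 'M[R]_(b + b, a + a) :=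
  (Jmx b)^T *m A^T *m Jmx a.

Section SpStSpGr.
Context {n k : nat}.
Implicit Types (U : 'M[R]_(n + n, k + k)) (P : 'M[R]_(n + n)).

Definition SpSt : set 'M[R]_(n + n, k + k) :=
  [set U | sadj U *m U = 1%:M].

Definition rho U : 'M[R]_(n + n) := U *m sadj U.

Definition tangentSpSt U : set 'M[R]_(n + n, k + k) :=
  [set D | sadj D *m U + sadj U *m D = 0].

Definition gSpSt U (D1 D2 : 'M[R]_(n + n, k + k)) : R :=
  \tr (D1^T *m (1%:M - 2^-1 *: ((Jmx n)^T *m U *m invmx (U^T *m U)
                                 *m U^T *m Jmx n))
       *m D2 *m invmx (U^T *m U)).

(* rho is polynomial on the ambient space; its differential at U is the
   restriction of D |-> 'D_D rho U to the tangent space. *)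
Definition verSpSt U : set 'M[R]_(n + n, k + k) :=
  [set D | tangentSpSt U D /\ 'D_D rho U = 0].

Definition horSpSt U : set 'M[R]_(n + n, k + k) :=
  [set D | tangentSpSt U D /\ forall E, verSpSt U E -> gSpSt U E D = 0].

End SpStSpGr.

Definition SpGr {n} k : set 'M[R]_(n + n) :=
  [set P | [/\ P *m P = P, \rank P = (k + k)%N & sadj P = P]].

(* The value does not depend on the representative U of P = rho U; the horizontal
   lifts D1, D2 of G1, G2 to U are unique. *)
Definition gSpGr {n} k (P G1 G2 : 'M[R]_(n + n)) : R :=
  get [set x | exists U D1 D2 : 'M[R]_(n + n, k + k),
    [/\ SpSt U /\ rho U = P,
        horSpSt U D1 /\ 'D_D1 rho U = G1,
        horSpSt U D2 /\ 'D_D2 rho U = G2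
      & x = gSpSt U D1 D2]].

Section LiftedGeodesic.
Context {n k : nat}.
Implicit Types U D : 'M[R]_(n + n, k + k).

Definition lifted_geodesic U D (c : R -> 'M[R]_(n + n, k + k)) : Prop :=
  [/\ smooth c /\ (forall t, SpSt (c t)),
      forall t, horSpSt (c t) (c^`() t)%classic,
      c 0 = U /\ (c^`() 0)%classic = D,
      geodesic (SpGr k) (gSpGr k) (rho \o c)
    & (rho \o c) 0 = rho U /\ ((rho \o c)^`() 0)%classic = 'D_D rho U].

Definition Omegabar U D : 'M[R]_(n + n) :=
  let G := invmx (U^T *m U) in
  D *m G *m U^T
  + Jmx n *m U *m G *m D^T
    *m (1%:M - (Jmx n)^T *m U *m G *m U^T *m Jmx n) *m Jmx n.

(* Exp_U(t D) *)
Definition ExpSpGr U D (t : R) : 'M[R]_(n + n, k + k) :=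
  let O := Omegabar U D in
  mexp (t *: (O - O^T)) *m mexp (t *: O^T) *m U.

End LiftedGeodesic.

End Symplectic.

(* Main.v *)
Require Import Defs.
From HB Require Import structures.
From mathcomp Require Import all_boot all_order all_algebra.
From mathcomp Require Import all_classical all_reals all_analysis.
From mathcomp Require Import ring lra.

Set Implicit Arguments.
Unset Strict Implicit.
Unset Printing Implicit Defensive.

Import Order.TTheory GRing.Theory Num.Theory.
Import numFieldNormedType.Exports.

Local Open Scope classical_set_scope.
Local Open Scope ring_scope.

(** The symplectic Grassmannian is an orbit of the symplectic group acting on
    projectors by conjugation, and its metric is induced by the right-invariant
    Frobenius metric of the group: [g_P(X, X)] is half of the least [|O|^2] among
    the Hamiltonian matrices [O] with [O P - P O = X].  The minimizer is the only
    such [O] that is horizontal, i.e. orthogonal to the matrices commuting with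
    [P] ([gSpGr_frob], [horizontal_exists]), and [Omegabar] computes it from a
    horizontal lift of [X] to the Stiefel manifold ([horizontal_Omegabar]).  That
    the metric is defined at every point uses that [rho] is onto
    ([rho_surjective]), which is the existence of symplectic bases.

    Let [W = Omegabar U D], [A = W - W^T] and [c(t) = exp(tA) exp(tW^T) U].  Then
    [c' = O c] with [O(t) = exp(tA) W exp(-tA)].  Since [exp(tA)] is orthogonal
    and symplectic and [exp(tW^T)] commutes with [W^T], [O(t)] is horizontal at
    [rho(c(t))]; moreover [O' = A O - O A = O O^T - O^T O] because [O - O^T = A].
    This is the Euler-Arnold equation of the invariant metric.

    The energy is shown to be critical without an expression for the horizontal
    lift of a tangent vector, which solves a Sylvester-like equation.  Along a
    variation [F(s, t)] the metric is bounded above by [|L|^2 / 2] for any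
    Hamiltonian [L] that generates [F_t], and below by [<B, L> - |B|^2 / 2] for any
    horizontal [B] ([gSpGr_bounds]).  Both [L] and [B] can be chosen polynomial in
    [F], [F_t] and [O], and equal to [O] at [s = 0]; hence the energy is squeezed
    between two functions of [s] that are differentiable under the integral sign
    and agree to first order at [s = 0].  Their common derivative is the integral
    of the derivative in [t] of [<O, [F_s, F]>], which vanishes at both ends.

    For the factorization, [W^T = U H^+ - H U^+] ([trmx_OmegabarE]), so that
    [W - W^T = X Y^T], while [W^T] maps the span of [-U] and [H] to itself.  Both
    exponentials are then moved through the rectangular matrices [X] and [[-U H]]
    by the rule that [A X = X B] implies [exp(A) X = X exp(B)]
    ([mexp_intertwine]). *)

(** * The symplectic adjoint *)

Section MatrixArithmetic.
Context {R : comPzRingType} {m n : nat}.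
Implicit Types A B : 'M[R]_(m, n).

Lemma mx_addE A B i j : (A + B) i j = A i j + B i j.
Proof. by rewrite mxE. Qed.

Lemma mx_oppE A i j : (- A) i j = - A i j.
Proof. by rewrite mxE. Qed.

Lemma mx_scaleE (a : R) A i j : (a *: A) i j = a * A i j.
Proof. by rewrite mxE. Qed.

Lemma mx_zeroE i j : (0 : 'M[R]_(m, n)) i j = 0.
Proof. by rewrite mxE. Qed.

End MatrixArithmetic.

(** Matrix products do not commute, but an identity that is linear in them holds
    as soon as it holds entrywise, over the commutative ring of the entries. *)
Ltac mxlin :=
  let i := fresh "i" in let j := fresh "j" in
  apply/matrixP => i j;
  rewrite ?(mx_addE, mx_oppE, mx_scaleE, mx_zeroE); ring.

Ltac mxexp :=
  rewrite ?(mulmxDl, mulmxDr, mulmxBl, mulmxBr, mulmxN, mulNmx, mulmxA, opprD,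
    opprK, mulmx1, mul1mx, mul0mx, mulmx0).

Section SymplecticAdjoint.
Context {R : realType}.

Lemma trmx_Jmx m : (Jmx m)^T = - Jmx m :> 'M[R]_(m + m).
Proof.
by rewrite /Jmx tr_block_mx opp_block_mx !trmx0 !linearN /= !trmx1 !oppr0 opprK.
Qed.


Lemma Jmx_Jmx m : Jmx m *m Jmx m = - 1%:M :> 'M[R]_(m + m).
Proof.
rewrite /Jmx mulmx_block !(mul0mx, mulmx0, mulmx1, mul1mx, add0r, addr0).
by rewrite (scalar_mx_block m m 1) opp_block_mx oppr0.
Qed.

Lemma trmx_Jmx_Jmx m : (Jmx m)^T *m Jmx m = 1%:M :> 'M[R]_(m + m).
Proof. by rewrite trmx_Jmx mulNmx Jmx_Jmx opprK. Qed.

Lemma Jmx_trmx_Jmx m : Jmx m *m (Jmx m)^T = 1%:M :> 'M[R]_(m + m).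
Proof. by rewrite trmx_Jmx mulmxN Jmx_Jmx opprK. Qed.

Lemma sadjK a b (A : 'M[R]_(a + a, b + b)) : sadj (sadj A) = A.
Proof.
rewrite /sadj !trmx_mul !trmxK !mulmxA -(mulmxA _ (Jmx b)) !trmx_Jmx.
by rewrite mulNmx mulmxN opprK !Jmx_Jmx mulNmx mulmxN mul1mx mulmx1 opprK.
Qed.

Lemma sadjM a b c (A : 'M[R]_(a + a, b + b)) (B : 'M[R]_(b + b, c + c)) :
  sadj (A *m B) = sadj B *m sadj A.
Proof.
rewrite /sadj trmx_mul !mulmxA; congr (_ *m _ *m _).
by rewrite -(mulmxA _ (Jmx b)) Jmx_trmx_Jmx mulmx1.
Qed.

Lemma sadjD a b (A B : 'M[R]_(a + a, b + b)) :
  sadj (A + B) = sadj A + sadj B.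
Proof. by rewrite /sadj linearD /= mulmxDr mulmxDl. Qed.

Lemma sadjN a b (A : 'M[R]_(a + a, b + b)) : sadj (- A) = - sadj A.
Proof. by rewrite /sadj linearN /= mulmxN mulNmx. Qed.

Lemma sadjZ a b (x : R) (A : 'M[R]_(a + a, b + b)) :
  sadj (x *: A) = x *: sadj A.
Proof. by rewrite /sadj linearZ /= -scalemxAr -scalemxAl. Qed.

Lemma sadj1 m : sadj 1%:M = 1%:M :> 'M[R]_(m + m).
Proof. by rewrite /sadj trmx1 mulmx1 trmx_Jmx_Jmx. Qed.

Lemma sadj_trmx a b (A : 'M[R]_(a + a, b + b)) : sadj A^T = (sadj A)^T.
Proof.
by rewrite /sadj !trmx_mul !trmxK !mulmxA !trmx_Jmx !(mulmxN, mulNmx).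
Qed.

Lemma mxtrace_sadj m (A : 'M[R]_(m + m)) : \tr (sadj A) = \tr A.
Proof. by rewrite /sadj mxtrace_mulC mulmxA Jmx_trmx_Jmx mul1mx mxtrace_tr. Qed.

End SymplecticAdjoint.

(** * The Frobenius inner product *)

Section Frobenius.
Context {R : realType}.

Definition frob {m n} (A B : 'M[R]_(m, n)) : R := \tr (A^T *m B).

Section Basics.
Context {m n : nat}.
Implicit Types A B C : 'M[R]_(m, n).

Lemma frobC A B : frob A B = frob B A.
Proof. by rewrite /frob -mxtrace_tr trmx_mul trmxK. Qed.

Lemma frobDr A B C : frob A (B + C) = frob A B + frob A C.
Proof. by rewrite /frob mulmxDr mxtraceD. Qed.

Lemma frobNr A B : frob A (- B) = - frob A B.
Proof. by rewrite /frob mulmxN linearN. Qed.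

Lemma frobBr A B C : frob A (B - C) = frob A B - frob A C.
Proof. by rewrite frobDr frobNr. Qed.

Lemma frobZr x A B : frob A (x *: B) = x * frob A B.
Proof. by rewrite /frob -scalemxAr linearZ. Qed.

Lemma frobBl A B C : frob (B - C) A = frob B A - frob C A.
Proof. by rewrite !(frobC _ A) frobBr. Qed.

Lemma frobE A B : frob A B = \sum_i \sum_j A i j * B i j.
Proof.
rewrite /frob /mxtrace exchange_big; apply: eq_bigr => j _.
by rewrite mxE; apply: eq_bigr => i _; rewrite mxE.
Qed.

Lemma frob_ge0 A : 0 <= frob A A.
Proof.
by rewrite frobE; do 2!(apply: sumr_ge0 => ? _); rewrite -expr2 sqr_ge0.
Qed.

Lemma frob_eq0 A : frob A A = 0 -> A = 0.
Proof.
rewrite frobE => /eqP; rewrite psumr_eq0; last first.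
  by move=> i _; apply: sumr_ge0 => j _; rewrite -expr2 sqr_ge0.
move=> /allP A0; apply/matrixP => i j; rewrite mxE.
have /implyP/(_ isT) := A0 i (mem_index_enum i); rewrite psumr_eq0; last first.
  by move=> k _; rewrite -expr2 sqr_ge0.
by move=> /allP/(_ j (mem_index_enum j))/=; rewrite mulf_eq0 orbb => /eqP.
Qed.

End Basics.

(** The normal equations are solvable because a vector in the kernel of [K K^T] is in
    the kernel of [K^T], the inner product being definite. *)
Lemma orthogonal_projection_row p q (K : 'M[R]_(p, q)) (v : 'rV[R]_q) :
  exists w : 'rV_p, (v - w *m K) *m K^T = 0.
Proof.
suff /submxP[w vw] : (v *m K^T <= K *m K^T)%MS.
  by exists w; rewrite mulmxBl vw mulmxA subrr.
rewrite submxE -mulmxA; set C := cokermx _.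
suff -> : K^T *m C = 0 by rewrite mulmx0.
apply: frob_eq0.
by rewrite /frob trmx_mul trmxK -mulmxA (mulmxA K) mulmx_coker mulmx0 mxtrace0.
Qed.

Lemma frob_mxvec m n (A B : 'M[R]_(m, n)) :
  mxvec A *m (mxvec B)^T = (frob A B)%:M.
Proof.
rewrite frobE; apply/rowP => k; rewrite !ord1 !mxE /= mulr1n.
rewrite (reindex _ (curry_mxvec_bij _ _)) /= pair_bigA /=.
by apply: eq_bigr => -[i j] _; rewrite mxE !mxvecE.
Qed.

Lemma orthogonal_projection p q m n
    (f : {linear 'M[R]_(p, q) -> 'M[R]_(m, n)}) (L : 'M[R]_(m, n)) :
  exists V, forall W, frob (L - f V) (f W) = 0.
Proof.
have [w /= Hw] := orthogonal_projection_row (lin_mx f) (mxvec L).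
exists (vec_mx w) => W.
have fE M : mxvec (f M) = mxvec M *m lin_mx f by rewrite mul_vec_lin.
have : mxvec (L - f (vec_mx w)) *m (mxvec (f W))^T = 0.
  by rewrite linearB /= !fE vec_mxK trmx_mul mulmxA Hw mul0mx.
by rewrite frob_mxvec => /matrixP/(_ 0 0); rewrite !mxE mulr1n.
Qed.

End Frobenius.

(** * Horizontal Hamiltonian matrices *)

Section Horizontal.
Context {R : realType} {n : nat}.
Implicit Types P O L Z B : 'M[R]_(n + n).

Definition hamiltonian L := sadj L = - L.

(** The equation says that [O^T] has no diagonal blocks for the decomposition into
    the image and the kernel of [P].  The trace form pairs these diagonal blocks
    perfectly with the matrices that commute with [P], so that this is the
    orthogonality of [O] to them. *)
Definition horizontal P O := hamiltonian O /\ O^T = P *m O^T + O^T *m P.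

Lemma hamiltonianD L B : hamiltonian L -> hamiltonian B -> hamiltonian (L + B).
Proof. by rewrite /hamiltonian sadjD => -> ->; rewrite opprD. Qed.

Lemma hamiltonianN L : hamiltonian L -> hamiltonian (- L).
Proof. by rewrite /hamiltonian sadjN => ->. Qed.

Lemma hamiltonian_trmx L : hamiltonian L -> hamiltonian L^T.
Proof. by rewrite /hamiltonian sadj_trmx => ->; rewrite linearN. Qed.

Lemma hamiltonian_commutator L P :
  sadj L = L -> sadj P = P -> hamiltonian (L *m P - P *m L).
Proof.
by move=> hL hP; rewrite /hamiltonian sadjD sadjN !sadjM hL hP opprB.
Qed.

Lemma idempotent_mulmxr P (PP : P *m P = P) m (A : 'M[R]_(m, n + n)) :
  A *m P *m P = A *m P.
Proof. by rewrite -mulmxA PP. Qed.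

Definition diag_part P L := P *m L *m P + (1%:M - P) *m L *m (1%:M - P).

Lemma hamiltonian_diag_part P L :
  sadj P = P -> hamiltonian L -> hamiltonian (diag_part P L).
Proof.
move=> hP hL; rewrite /hamiltonian /diag_part.
rewrite !(sadjD, sadjM, sadjN, sadj1) hP hL !(mulmxN, mulNmx) !mulmxA.
by rewrite opprD.
Qed.

Lemma diag_part_comm P L : P *m P = P ->
  diag_part P L *m P = P *m diag_part P L.
Proof.
move=> PP; rewrite /diag_part; mxexp.
by rewrite !(idempotent_mulmxr PP, PP); mxlin.
Qed.

Lemma horizontal_block P O : P *m P = P -> horizontal P O -> P *m O^T *m P = 0.
Proof.
move=> PP [_ hO].
have : P *m O^T *m P = P *m O^T *m P + P *m O^T *m P.
  by rewrite {1}hO mulmxDr mulmxDl !mulmxA PP -!mulmxA PP.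
by move/eqP; rewrite -subr_eq0 opprD addrA subrr sub0r oppr_eq0 => /eqP.
Qed.

Lemma horizontal_coblock P O : P *m P = P -> horizontal P O ->
  (1%:M - P) *m O^T *m (1%:M - P) = 0.
Proof.
move=> PP hO; have POP := horizontal_block PP hO; case: hO => _ OT.
by mxexp; rewrite POP {1}OT; mxlin.
Qed.

Lemma horizontal_blocks P O : hamiltonian O -> P *m O^T *m P = 0 ->
  (1%:M - P) *m O^T *m (1%:M - P) = 0 -> horizontal P O.
Proof.
move=> hO POP QOQ; split=> //; apply/eqP; rewrite -subr_eq0 -[X in _ == X]QOQ.
by apply/eqP; mxexp; rewrite POP; mxlin.
Qed.

Lemma horizontal_orthogonal P O Z : P *m P = P -> horizontal P O ->
  Z *m P = P *m Z -> frob O Z = 0.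
Proof.
move=> PP hO ZP; have POP := horizontal_block PP hO.
have e : \tr (O^T *m P *m Z) = 0.
  by rewrite -PP mulmxA -mulmxA -ZP mulmxA mxtrace_mulC !mulmxA POP mul0mx mxtrace0.
rewrite /frob; case: hO => _ ->; rewrite mulmxDl mxtraceD e addr0.
by rewrite -mulmxA mxtrace_mulC -mulmxA ZP mulmxA e.
Qed.

Lemma diag_partZ P x L : diag_part P (x *: L) = x *: diag_part P L.
Proof. by rewrite /diag_part -!scalemxAr -!scalemxAl scalerDr. Qed.

Lemma frob_diag_part P A B :
  frob A (diag_part P B) = frob (diag_part P A^T)^T B.
Proof.
rewrite /frob /diag_part trmxK mulmxDr [X in _ = \tr X]mulmxDl !mxtraceD !mulmxA.
by rewrite mxtrace_mulC [X in _ + X]mxtrace_mulC !mulmxA.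
Qed.

(** Removing from [L] its orthogonal projection to the Hamiltonian matrices that
    commute with [P] does not change the commutator with [P].  The result
    [O] is horizontal: with [W] the diagonal part of [O^T], the pairing of [O] with
    the diagonal part of [W^T] is the squared norm of [W], which is thus zero. *)
Lemma horizontal_exists P L : P *m P = P -> sadj P = P -> hamiltonian L ->
  exists2 O, horizontal P O & O *m P - P *m O = L *m P - P *m L.
Proof.
move=> PP sP hL.
pose f V := diag_part P (V - sadj V).
have f_lin : linear f.
  move=> x A B; rewrite /f /diag_part sadjD sadjZ; mxexp.
  by rewrite -?(scalemxAr, scalemxAl) ?mulmxA -?(scalemxAr, scalemxAl); mxlin.
pose fL : {linear 'M[R]_(n + n) -> 'M[R]_(n + n)} :=
  HB.pack f (GRing.isLinear.Build _ _ _ _ f f_lin).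
have [V HV] := orthogonal_projection fL L.
have hf W : hamiltonian (f W).
  apply: hamiltonian_diag_part => //.
  by rewrite /hamiltonian sadjD sadjN sadjK opprB addrC.
pose O := L - f V.
have hO : hamiltonian O by apply: hamiltonianD => //; exact: hamiltonianN.
exists O; last by rewrite /O mulmxBl mulmxBr diag_part_comm //; mxlin.
pose W := diag_part P O^T.
have hW : hamiltonian W.
  by apply: hamiltonian_diag_part => //; exact: hamiltonian_trmx.
have W0 : W = 0.
  apply: trmx_inj; rewrite trmx0; apply: frob_eq0.
  have := HV W^T; rewrite /= /f -/(f V) -/O.
  have -> : W^T - sadj W^T = 2 *: W^T.
    by rewrite (hamiltonian_trmx hW) opprK; mxlin.
  rewrite diag_partZ frobZr frob_diag_part -/W.
  by move=> /eqP; rewrite mulf_eq0 pnatr_eq0 /= => /eqP.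
have POP : P *m O^T *m P = 0.
  have : P *m W *m P = 0 by rewrite W0 mulmx0 mul0mx.
  rewrite /W /diag_part; mxexp; rewrite !(idempotent_mulmxr PP, PP) => e.
  by rewrite -[RHS]e; mxlin.
apply: horizontal_blocks => //.
by move: W0; rewrite /W /diag_part POP add0r.
Qed.

End Horizontal.

(** * Symplectic bases *)

Section SymplecticBasis.
Context {R : realType} {n : nat}.
Implicit Types P : 'M[R]_(n + n).

Notation J := (Jmx n).

Definition symplectic_family j (E F : 'M[R]_(n + n, j)) :=
  [/\ E^T *m J *m E = 0, F^T *m J *m F = 0 & E^T *m J *m F = 1%:M].

Lemma skew_form_trmx j l (A : 'M[R]_(n + n, j)) (B : 'M[R]_(n + n, l)) :
  (A^T *m J *m B)^T = - (B^T *m J *m A).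
Proof. by rewrite !trmx_mul trmxK trmx_Jmx mulNmx mulmxN mulmxA. Qed.

Lemma skew_form_col (e : 'cV[R]_(n + n)) : e^T *m J *m e = 0.
Proof.
have /matrixP/(_ 0 0) := skew_form_trmx e e.
rewrite !mxE => h; apply/matrixP => i j; rewrite !ord1 [RHS]mxE mxE.
by lra.
Qed.

Lemma sadj_idE P : sadj P = P -> P^T *m J = J *m P.
Proof.
by move=> {2}<-; rewrite /sadj !mulmxA Jmx_trmx_Jmx mul1mx.
Qed.

(** For dimension reasons the image of [P] contains a nonzero [e] that is
    [J]-orthogonal to the family, and the form is nondegenerate on the image, which
    provides a partner [f] of [e]; subtracting the components of [f] along the
    family makes it orthogonal to the family too. *)
Lemma symplectic_family_extend P j (E F : 'M[R]_(n + n, j)) :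
  P *m P = P -> sadj P = P -> (j + j < \rank P)%N ->
  P *m E = E -> P *m F = F -> symplectic_family E F ->
  exists e f : 'cV[R]_(n + n),
    [/\ P *m e = e, P *m f = f & symplectic_family (row_mx e E) (row_mx f F)].
Proof.
move=> PP sP jr PE PF [EE FF EF].
have [v [vP vU v0]] : exists v : 'rV_(n + n),
    [/\ v *m P^T = v, v *m row_mx (J *m E) (J *m F) = 0 & v != 0].
  have /rowV0Pn[v] : (P^T :&: kermx (row_mx (J *m E) (J *m F)))%MS != 0.
    rewrite -mxrank_eq0 -lt0n.
    have := mxrank_mul_ker P^T (row_mx (J *m E) (J *m F)).
    have := rank_leq_col (P^T *m row_mx (J *m E) (J *m F)).
    rewrite mxrank_tr => h e; rewrite -(ltn_add2l (j + j)) addn0.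
    by rewrite (leq_trans jr) // -e leq_add2r.
  rewrite sub_capmx => /andP[/submxP[y ->] /sub_kermxP vK] v0.
  by exists (y *m P^T); split=> //; rewrite -mulmxA -trmx_mul PP.
move: vU; rewrite mul_mx_row -[0]row_mx0 => /eq_row_mx[vE vF].
pose w := v *m J.
have wP : w *m P = w by rewrite /w -mulmxA -sadj_idE // mulmxA vP.
have w0 : frob w^T w^T != 0.
  apply/eqP => /frob_eq0 => w0; move/eqP: v0; apply.
  rewrite -[v]mulmx1 -Jmx_trmx_Jmx mulmxA -/w.
  by rewrite -[w]trmxK w0 trmx0 mul0mx.
pose f0 := (frob w^T w^T)^-1 *: (P *m w^T).
have vf0 : v *m J *m f0 = 1%:M.
  rewrite /f0 -scalemxAr mulmxA -/w wP [w *m _]mx11_scalar -trace_mx11.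
  rewrite scale_scalar_mx -[X in \tr (X *m _)]trmxK mulVf //.
have FE : F^T *m J *m E = - 1%:M.
  by rewrite -[LHS]opprK -skew_form_trmx EF trmx1.
pose f := f0 + E *m (F^T *m J *m f0) - F *m (E^T *m J *m f0).
have vf : v *m J *m f = 1%:M.
  rewrite /f; mxexp.
  by rewrite -(mulmxA v J E) -(mulmxA v J F) vE vF !mul0mx subr0 addr0.
have Ef : E^T *m J *m f = 0.
  by rewrite /f; mxexp; rewrite EE EF; mxexp; mxlin.
have Ff : F^T *m J *m f = 0.
  by rewrite /f; mxexp; rewrite FE FF; mxexp; mxlin.
exists v^T, f; split.
- by rewrite -[in RHS]vP trmx_mul trmxK.
- rewrite /f !mulmxDr mulmxN !(mulmxA P) PE PF; congr (_ + _ - _).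
  by rewrite /f0 -scalemxAr mulmxA PP.
have Ev : E^T *m J *m v^T = 0.
  by rewrite -[LHS]opprK -skew_form_trmx trmxK -mulmxA vE trmx0 oppr0.
have fF : f^T *m J *m F = 0.
  by rewrite -[LHS]trmxK skew_form_trmx Ff oppr0 trmx0.
split; rewrite tr_row_mx mul_col_mx mul_col_row ?skew_form_col ?trmxK.
- by rewrite -(mulmxA v) vE EE Ev block_mx0.
- by rewrite FF Ff fF block_mx0.
- by rewrite -(mulmxA v J F) vF vf EF Ef -scalar_mx_block.
Qed.

Lemma symplectic_family_exists P j :
  P *m P = P -> sadj P = P -> (j + j <= \rank P)%N ->
  exists E F : 'M[R]_(n + n, j),
    [/\ P *m E = E, P *m F = F & symplectic_family E F].
Proof.
move=> PP sP; elim: j => [_|j IHj jP].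
  by exists 0, 0; split; [rewrite mulmx0..|split; apply/matrixP => -[]].
have [|E [F [PE PF EF]]] := IHj.
  by apply: leq_trans jP; rewrite leq_add.
have [|e [f [Pe Pf ef]]] := symplectic_family_extend PP sP _ PE PF EF.
  by apply: leq_trans jP; rewrite addSn ltnS addnS leqnSn.
exists (row_mx e E), (row_mx f F); split=> //.
  by rewrite (mul_mx_row P e E) Pe PE.
by rewrite (mul_mx_row P f F) Pf PF.
Qed.

(** A symplectic family [U] of maximal size in the image of [P] spans it by a rank
    argument, so that [P = U M] and [U U^+ P = P]. *)
Lemma rho_surjective k P : SpGr k P ->
  exists2 U : 'M[R]_(n + n, k + k), SpSt U & rho U = P.
Proof.
move=> [PP rP sP].
have [|E [F [PE PF [EE FF EF]]]] := @symplectic_family_exists P k PP sP.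
  by rewrite rP.
pose U := row_mx E F.
have PU : P *m U = U by rewrite mul_mx_row PE PF.
have UU : sadj U *m U = 1%:M.
  have FE : F^T *m J *m E = - 1%:M.
    by rewrite -[LHS]opprK -skew_form_trmx EF trmx1.
  rewrite /sadj -mulmxA -mulmxA tr_row_mx (mulmxA _ J) mul_col_mx mul_col_row.
  by rewrite EE FF EF FE -/(Jmx k) trmx_Jmx_Jmx.
exists U => //; rewrite /rho.
have UP : U *m sadj U *m P = U *m sadj U.
  by rewrite -{1}sP -mulmxA -sadjM PU.
have /submxP[M PM] : (P^T <= U^T)%MS.
  have UrP : (U^T <= P^T)%MS by rewrite -PU trmx_mul submxMl.
  rewrite -(geq_leqif (mxrank_leqif_sup UrP)) !mxrank_tr rP.
  rewrite -[X in (X <= _)%N](mxrank1 R) -UU.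
  by rewrite mxrankM_maxr.
have PU' : P = U *m M^T by rewrite -[P]trmxK PM trmx_mul trmxK.
by rewrite -UP PU' mulmxA -(mulmxA U) UU mulmx1.
Qed.

End SymplecticBasis.

(** * Calculus of matrix-valued functions *)

Section MatrixDerivative.
Context {R : realType} {V : normedModType R}.
Implicit Types (t v : V).

Lemma is_derive_mxP m n (M : V -> 'M[R]_(m, n)) M' t v :
  is_derive t v M M' <->
  forall i j, is_derive t v (fun x => M x i j) (M' i j).
Proof.
split=> [dM i j|dM].
  have /derivable_mxP dMij : derivable M t v by [].
  apply: DeriveDef; first exact: dMij.
  have -> : M' = 'D_v M t by rewrite derive_val.
  by rewrite derive_mx ?mxE.
have dM1 : derivable M t v by apply/derivable_mxP => i j.
apply: DeriveDef => //; rewrite derive_mx //; apply/matrixP => i j.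
by rewrite mxE derive_val.
Qed.

Lemma is_derive_mulmx m n p (f : V -> 'M[R]_(m, n)) (g : V -> 'M[R]_(n, p))
    f' g' t v :
  is_derive t v f f' -> is_derive t v g g' ->
  is_derive t v (fun x => f x *m g x) (f' *m g t + f t *m g').
Proof.
move=> /is_derive_mxP df /is_derive_mxP dg; apply/is_derive_mxP => i j.
have -> : (fun x => (f x *m g x) i j) =
          \sum_k (fun x => f x i k) * (fun x => g x k j).
  by apply/funext => x; rewrite mxE fct_sumE.
apply: is_derive_eq.
rewrite !mxE -big_split; apply: eq_bigr => k _ /=.
by rewrite /GRing.scale /=; ring.
Qed.

Lemma is_derive_trmx m n (f : V -> 'M[R]_(m, n)) f' t v :
  is_derive t v f f' -> is_derive t v (fun x => (f x)^T) f'^T.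
Proof.
move=> /is_derive_mxP df; apply/is_derive_mxP => i j; rewrite mxE.
by under eq_fun do rewrite mxE.
Qed.

Lemma is_derive_mulmxl m n p (A : 'M[R]_(m, n)) (g : V -> 'M[R]_(n, p)) g' t v :
  is_derive t v g g' -> is_derive t v (fun x => A *m g x) (A *m g').
Proof.
move=> dg; have := is_derive_mulmx (is_derive_cst A t v) dg.
by rewrite mul0mx add0r.
Qed.

Lemma is_derive_mulmxr m n p (A : 'M[R]_(n, p)) (g : V -> 'M[R]_(m, n)) g' t v :
  is_derive t v g g' -> is_derive t v (fun x => g x *m A) (g' *m A).
Proof.
move=> dg; have := is_derive_mulmx dg (is_derive_cst A t v).
by rewrite mulmx0 addr0.
Qed.

Lemma is_derive_sadj a b (f : V -> 'M[R]_(a + a, b + b)) f' t v :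
  is_derive t v f f' -> is_derive t v (fun x => sadj (f x)) (sadj f').
Proof. by move=> df; exact/is_derive_mulmxr/is_derive_mulmxl/is_derive_trmx. Qed.

Lemma is_derive_frob m n (f g : V -> 'M[R]_(m, n)) f' g' t v :
  is_derive t v f f' -> is_derive t v g g' ->
  is_derive t v (fun x => frob (f x) (g x)) (frob f' (g t) + frob (f t) g').
Proof.
move=> /is_derive_trmx df dg.
have /is_derive_mxP dfg := is_derive_mulmx df dg.
have -> : (fun x => frob (f x) (g x)) =
          \sum_i (fun x => ((f x)^T *m g x) i i).
  by apply/funext => x; rewrite fct_sumE.
apply: is_derive_eq; rewrite /frob -mxtraceD /mxtrace.
by apply: eq_bigr.
Qed.

End MatrixDerivative.

Section MatrixLimit.
Context {R : realType} {T : Type} {F : set_system T} {FF : Filter F}.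

Lemma cvg_mxP m n (f : T -> 'M[R]_(m, n)) (L : 'M[R]_(m, n)) :
  f @ F --> L <-> forall i j, f x i j @[x --> F] --> L i j.
Proof.
split=> [cf i j|cf].
  apply: (@cvg_comp _ _ _ f (fun M : 'M[R]_(m, n) => M i j) _ (nbhs L)) => //.
  exact: coord_continuous.
apply/cvgrPdist_le => e e0; near=> y.
rewrite /Num.Def.normr/= mx_normrE (bigmax_le _ (ltW e0))//= => i _.
rewrite !mxE; move: i; near: y; apply: filter_forall => /= i.
exact: ((cvgrPdist_le _ _).1 (cf i.1 i.2)).
Unshelve. all: by end_near. Qed.

Lemma cvg_mulmx m n p (f : T -> 'M[R]_(m, n)) (g : T -> 'M[R]_(n, p))
    (A : 'M[R]_(m, n)) (B : 'M[R]_(n, p)) :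
  f @ F --> A -> g @ F --> B -> f x *m g x @[x --> F] --> A *m B.
Proof.
move=> /cvg_mxP cf /cvg_mxP cg; apply/cvg_mxP => i j.
under eq_fun do rewrite mxE; rewrite mxE.
by apply: cvg_big => // [|k _]; [exact: add_continuous|apply: cvgM].
Qed.

Lemma cvg_trmx m n (f : T -> 'M[R]_(m, n)) (A : 'M[R]_(m, n)) :
  f @ F --> A -> (f x)^T @[x --> F] --> A^T.
Proof.
move=> /cvg_mxP cf; apply/cvg_mxP => i j.
by under eq_fun do rewrite mxE; rewrite mxE; exact: cf.
Qed.

Lemma cvg_frob m n (f g : T -> 'M[R]_(m, n)) (A B : 'M[R]_(m, n)) :
  f @ F --> A -> g @ F --> B -> frob (f x) (g x) @[x --> F] --> frob A B.
Proof.
move=> /cvg_trmx cf cg; have /cvg_mxP cfg := cvg_mulmx cf cg.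
by apply: cvg_big => //; exact: add_continuous.
Qed.

End MatrixLimit.

Section MatrixContinuity.
Context {R : realType} {T : topologicalType}.

Lemma continuous_mulmx m n p (f : T -> 'M[R]_(m, n)) (g : T -> 'M[R]_(n, p)) :
  continuous f -> continuous g -> continuous (fun x => f x *m g x).
Proof. by move=> cf cg x; apply: cvg_mulmx; [exact: cf|exact: cg]. Qed.

Lemma continuous_trmx m n (f : T -> 'M[R]_(m, n)) :
  continuous f -> continuous (fun x => (f x)^T).
Proof. by move=> cf x; apply: cvg_trmx; exact: cf. Qed.

Lemma continuous_frob m n (f g : T -> 'M[R]_(m, n)) :
  continuous f -> continuous g -> continuous (fun x => frob (f x) (g x)).
Proof. by move=> cf cg x; apply: cvg_frob; [exact: cf|exact: cg]. Qed.

Lemma continuous_addmx m n (f g : T -> 'M[R]_(m, n)) :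
  continuous f -> continuous g -> continuous (fun x => f x + g x).
Proof. by move=> cf cg x; apply: cvgD; [exact: cf|exact: cg]. Qed.

Lemma continuous_submx m n (f g : T -> 'M[R]_(m, n)) :
  continuous f -> continuous g -> continuous (fun x => f x - g x).
Proof. by move=> cf cg x; apply: cvgB; [exact: cf|exact: cg]. Qed.

End MatrixContinuity.

Lemma is_derive_continuous {R : realType} m n (f f' : R -> 'M[R]_(m, n)) :
  (forall t, is_derive t (1 : R) f (f' t)) -> continuous f.
Proof.
move=> df t; apply: differentiable_continuous.
by apply/derivable1_diffP; have [] := df t.
Qed.

(** * The matrix exponential *)

Section MatrixExponentialTheory.
Context {R : realType}.

(** Comparison with the exponential series of [K |x|]; this covers the entries of
    the exponential of a matrix and the derived power series. *)
Lemma is_cvg_exp_pseries (a : R ^nat) (C K x : R) :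
  (forall k, `|a k| <= C * K ^+ k) ->
  cvgn (pseries (fun k => (k`!%:R)^-1 * a k) x).
Proof.
move=> aK; apply: normed_cvg.
have K0 k : 0 <= C * K ^+ k by exact: le_trans (aK k).
have xk0 k : 0 <= (k`!%:R)^-1 * `|x| ^+ k.
  by rewrite mulr_ge0 ?invr_ge0 ?ler0n ?exprn_ge0.
have expE k : (C *: exp_coeff (K * `|x|)) k =
    C * K ^+ k * ((k`!%:R)^-1 * `|x| ^+ k).
  by rewrite fctE /GRing.scale /= /exp_coeff /= exprMn; ring.
apply: (@series_le_cvg _ _ (C *: exp_coeff (K * `|x|))) => [k|k|k|].
- exact: normr_ge0.
- by rewrite expE mulr_ge0.
- rewrite expE /= !normrM normfV normrX normr_nat mulrAC.
  by rewrite [leLHS]mulrC ler_wpM2r.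
- exact/is_cvg_seriesZ/is_cvg_series_exp_coeff.
Qed.

Section Exponential.
Context {m : nat}.
Implicit Types A B X : 'M[R]_m.

Lemma exprmxS A k : A ^+ k.+1 = A *m A ^+ k.
Proof. exact: exprS. Qed.

Lemma expmx_entry_bound A k i j :
  `|(A ^+ k) i j| <= (\sum_i \sum_j `|A i j|) ^+ k.
Proof.
set K := \sum_i _.
have K0 : 0 <= K by do 2!apply: sumr_ge0 => ? _.
elim: k i j => [|k IHk] i j.
  by rewrite !expr0 mxE; case: eqP => _; rewrite ?normr1 // normr0 ler01.
rewrite exprmxS mxE (le_trans (ler_norm_sum _ _ _)) //.
apply: (@le_trans _ _ (\sum_l `|A i l| * K ^+ k)).
  by apply: ler_sum => l _; rewrite normrM ler_wpM2l.
rewrite -mulr_suml exprS ler_wpM2r ?exprn_ge0 //.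
rewrite /K [leRHS](bigD1 i) //= lerDl; do 2!apply: sumr_ge0 => ? _; exact: normr_ge0.
Qed.

Lemma exprmxZ t A k : (t *: A) ^+ k = t ^+ k *: A ^+ k.
Proof.
elim: k => [|k IHk]; first by rewrite !expr0 scale1r.
by rewrite !exprmxS IHk exprS -scalemxAl -scalemxAr scalerA.
Qed.

Lemma mexp_series_entry A t n i j :
  series (fun k => (k`!%:R)^-1 *: (t *: A) ^+ k) n i j =
  pseries (fun k => (k`!%:R)^-1 * (A ^+ k) i j) t n.
Proof.
rewrite /series /= summxE; apply: eq_bigr => k _.
by rewrite exprmxZ !mxE mulrA mulrAC.
Qed.

Lemma is_cvg_mexp_pseries A i j t :
  cvgn (pseries (fun k => (k`!%:R)^-1 * (A ^+ k) i j) t).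
Proof.
apply: (@is_cvg_exp_pseries _ 1 (\sum_i \sum_j `|A i j|)) => k.
by rewrite mul1r expmx_entry_bound.
Qed.

Lemma cvg_mexp A : series (fun k => (k`!%:R)^-1 *: A ^+ k) @ \oo --> mexp A.
Proof.
apply/cvg_ex; exists (\matrix_(i, j)
  limn (pseries (fun k => (k`!%:R)^-1 * (A ^+ k) i j) 1)).
apply/cvg_mxP => i j; rewrite mxE -[A in X in X @ _]scale1r.
under eq_fun do rewrite mexp_series_entry.
exact: is_cvg_mexp_pseries.
Qed.

Lemma mexp_entry A t i j :
  mexp (t *: A) i j = limn (pseries (fun k => (k`!%:R)^-1 * (A ^+ k) i j) t).
Proof.
have /cvg_mxP/(_ i j)/cvg_lim <- // := @cvg_mexp (t *: A).
by congr (limn _); apply/funext => n; rewrite mexp_series_entry.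
Qed.

Lemma is_derive_mexp A t :
  is_derive t (1 : R) (fun s => mexp (s *: A)) (A *m mexp (t *: A)).
Proof.
apply/is_derive_mxP => i j.
pose a i j k := (A ^+ k) i j.
pose c i j k := (k`!%:R)^-1 * a i j k.
have -> : (fun s => mexp (s *: A) i j) = fun s => limn (pseries (c i j) s).
  by apply/funext => s; rewrite mexp_entry.
have dE (b : R ^nat) :
    pseries_diffs (fun k => (k`!%:R)^-1 * b k) = fun k => (k`!%:R)^-1 * b k.+1.
  apply/funext => k; rewrite /pseries_diffs mulrA factS natrM invfM mulrA.
  by rewrite mulfV ?pnatr_eq0 // mul1r.
have cdE : pseries (pseries_diffs (c i j)) t = fun n =>
    (A *m series (fun k => (k`!%:R)^-1 *: (t *: A) ^+ k) n) i j.
  apply/funext => n; rewrite dE mxE.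
  under [RHS]eq_bigr do rewrite mexp_series_entry mulr_sumr.
  rewrite exchange_big /pseries /series /=; apply: eq_bigr => k _.
  rewrite /a exprmxS mxE mulr_sumr mulr_suml.
  by apply: eq_bigr => l _; ring.
have -> : (A *m mexp (t *: A)) i j = limn (pseries (pseries_diffs (c i j)) t).
  apply/esym/cvg_lim => //; rewrite cdE.
  by apply: (cvg_mxP _ _).1; apply: cvg_mulmx; [exact: cvg_cst|exact: cvg_mexp].
pose K := \sum_i \sum_j `|A i j|.
have cK C (b : R ^nat) : (forall k, `|b k| <= C * K ^+ k) ->
    forall k, `|b k.+1| <= (C * K) * K ^+ k.
  by move=> bK k; rewrite -mulrA -exprS.
have aK : forall k, `|a i j k| <= 1 * K ^+ k.
  by move=> k; rewrite mul1r expmx_entry_bound.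
have aK1 := cK _ _ aK; have aK2 := cK _ _ aK1.
apply: (@pseries_snd_diffs _ _ (`|t| + 1)).
- exact: is_cvg_exp_pseries aK.
- by rewrite dE; exact: is_cvg_exp_pseries aK1.
- by rewrite !dE; exact: is_cvg_exp_pseries aK2.
- by rewrite ltr_normr ltrDl ltr01.
Qed.

End Exponential.

(** A linear map that intertwines two matrices intertwines their powers, hence
    the partial sums of their exponentials. *)
Lemma mexp_intertwine m n (A : 'M[R]_m) (B : 'M[R]_n) (X : 'M[R]_(m, n)) :
  A *m X = X *m B -> mexp A *m X = X *m mexp B.
Proof.
move=> AX.
have AXn k : A ^+ k *m X = X *m B ^+ k.
  elim: k => [|k IHk]; first by rewrite !expr0 mul1mx mulmx1.
  rewrite !exprmxS -mulmxA IHk.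
  by rewrite !mulmxA AX.
have cA : series (fun k => (k`!%:R)^-1 *: A ^+ k) k *m X @[k --> \oo]
    --> mexp A *m X by apply: cvg_mulmx; [exact: cvg_mexp|exact: cvg_cst].
have cB : X *m series (fun k => (k`!%:R)^-1 *: B ^+ k) k @[k --> \oo]
    --> X *m mexp B by apply: cvg_mulmx; [exact: cvg_cst|exact: cvg_mexp].
rewrite -(cvg_lim _ cA) // -(cvg_lim _ cB) //; congr (limn _).
apply/funext => k; rewrite /series /= mulmx_suml mulmx_sumr.
by apply: eq_bigr => l _; rewrite -scalemxAl -scalemxAr AXn.
Qed.

Lemma mexpZ_intertwine m n (A : 'M[R]_m) (B : 'M[R]_n) (X : 'M[R]_(m, n)) t :
  A *m X = X *m B -> mexp (t *: A) *m X = X *m mexp (t *: B).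
Proof.
by move=> AX; apply: mexp_intertwine; rewrite -scalemxAl -scalemxAr AX.
Qed.

Lemma mexp0 m : mexp 0 = 1%:M :> 'M[R]_m.
Proof.
apply/cvg_lim => //; rewrite -(cvg_shiftS _); apply: cvg_near_cst.
apply: nearW => n; rewrite /series /= big_nat_recl //= big1 => [|k _].
  by rewrite fact0 invr1 scale1r expr0 addr0.
by rewrite exprS mul0r scaler0.
Qed.

Lemma trmx_mexp m (A : 'M[R]_m) : (mexp A)^T = mexp A^T.
Proof.
have cA : (series (fun k => (k`!%:R)^-1 *: A ^+ k) k)^T @[k --> \oo]
    --> (mexp A)^T by apply: cvg_trmx; exact: cvg_mexp.
have trX k : (A ^+ k)^T = A^T ^+ k.
  elim: k => [|k IHk]; first by rewrite !expr0 trmx1.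
  by rewrite exprSr -[_ * A]/(_ *m A) trmx_mul IHk exprmxS.
rewrite -(cvg_lim _ cA) //; congr (limn _); apply/funext => k.
by rewrite /series /= linear_sum; apply: eq_bigr => l _; rewrite linearZ /= trX.
Qed.

Lemma sadj_mexp m (A : 'M[R]_(m + m)) : sadj (mexp A) = mexp (sadj A).
Proof.
rewrite {1}/sadj trmx_mexp -mulmxA.
rewrite (@mexp_intertwine _ _ A^T (sadj A) (Jmx m)).
  by rewrite mulmxA trmx_Jmx_Jmx mul1mx.
by rewrite /sadj !mulmxA Jmx_trmx_Jmx mul1mx.
Qed.

Lemma is_derive0_cst m n (f : R -> 'M[R]_(m, n)) s t :
  (forall x, is_derive x (1 : R) f 0) -> f s = f t.
Proof.
move=> df; apply/matrixP => i j.
apply: (@is_derive_0_is_cst _ (fun x => f x i j)) => x.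
by have /is_derive_mxP/(_ i j) := df x; rewrite mxE.
Qed.

Lemma mexpZC m (A : 'M[R]_m) t : A *m mexp (t *: A) = mexp (t *: A) *m A.
Proof. by rewrite -(mexpZ_intertwine t (erefl (A *m A))). Qed.

Lemma mexpNZ m (A : 'M[R]_m) t : mexp (t *: A) *m mexp (t *: - A) = 1%:M.
Proof.
pose f s := mexp (s *: A) *m mexp (s *: - A).
have -> : 1%:M = f 0 by rewrite /f !scale0r mexp0 mulmx1.
apply: (@is_derive0_cst _ _ f) => s; rewrite /f.
apply: is_derive_eq (is_derive_mulmx (is_derive_mexp A s) (is_derive_mexp (- A) s)) _.
by rewrite mexpZC mulNmx mulmxN mulmxA subrr.
Qed.

End MatrixExponentialTheory.

(** * The metric in terms of horizontal Hamiltonian matrices *)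

Section StiefelMetric.
Context {R : realType} {n k : nat}.
Variable U : 'M[R]_(n + n, k + k).
Hypothesis U_SpSt : SpSt U.

Implicit Types (D E : 'M[R]_(n + n, k + k)) (O B : 'M[R]_(n + n)).

Local Notation J := (Jmx n).
Local Notation P := (rho U).
Local Notation G := (invmx (U^T *m U)).
Local Notation Pi := (U *m G *m U^T).

Lemma SpSt_sadj_mul : sadj U *m U = 1%:M.
Proof. exact: U_SpSt. Qed.

Lemma rho_idem : P *m P = P.
Proof. by rewrite /rho mulmxA -(mulmxA U) SpSt_sadj_mul mulmx1. Qed.

Lemma sadj_rho : sadj P = P.
Proof. by rewrite /rho sadjM sadjK. Qed.

Lemma rho_mul : P *m U = U.
Proof. by rewrite /rho -mulmxA SpSt_sadj_mul mulmx1. Qed.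

Lemma mul_rho : sadj U *m P = sadj U.
Proof. by rewrite /rho mulmxA SpSt_sadj_mul mul1mx. Qed.

Lemma SpGr_rho : SpGr k P.
Proof.
split; [exact: rho_idem| |exact: sadj_rho].
apply/eqP; rewrite eqn_leq (leq_trans (mxrankM_maxl _ _) (rank_leq_col _)) /=.
rewrite -[X in (X <= _)%N](mxrank1 R) -SpSt_sadj_mul -{2}rho_mul mulmxA.
exact: leq_trans (mxrankM_maxl _ _) (mxrankM_maxr _ _).
Qed.

Lemma gram_unit : U^T *m U \in unitmx.
Proof.
rewrite -row_free_unit -kermx_eq0; set K := kermx _.
have KU : K *m U^T = 0.
  apply: trmx_inj; rewrite trmx0; apply: frob_eq0.
  by rewrite /frob trmxK trmx_mul trmxK mulmxA -(mulmxA K) mulmx_ker mul0mx mxtrace0.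
by rewrite -[K]mulmx1 -trmx1 -SpSt_sadj_mul trmx_mul mulmxA KU mul0mx.
Qed.

Lemma trmx_gram_inv : G^T = G.
Proof. by rewrite trmx_inv trmx_mul trmxK. Qed.

Lemma trmx_Pi : Pi^T = Pi.
Proof. by rewrite !trmx_mul trmxK trmx_gram_inv mulmxA. Qed.

Lemma Pi_mul : Pi *m U = U.
Proof. by rewrite -!mulmxA mulVmx ?mulmx1 // gram_unit. Qed.

Lemma Pi_rho : Pi *m P = P.
Proof. by rewrite /rho mulmxA Pi_mul. Qed.

Lemma is_derive_rho D : is_derive U D (@rho R n k) (D *m sadj U + U *m sadj D).
Proof.
have dU := is_derive_id U D.
exact: is_derive_mulmx dU (is_derive_sadj dU).
Qed.

Lemma derive_rho D : 'D_D (@rho R n k) U = D *m sadj U + U *m sadj D.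
Proof. by have dr := is_derive_rho D; rewrite derive_val. Qed.

Lemma derive_rho_mul O : hamiltonian O ->
  'D_(O *m U) (@rho R n k) U = O *m P - P *m O.
Proof. by move=> hO; rewrite derive_rho sadjM hO /rho !mulmxN !mulmxA. Qed.

Lemma gSpStC D E : gSpSt U D E = gSpSt U E D.
Proof.
rewrite /gSpSt -mxtrace_tr !trmx_mul trmxK trmx_gram_inv mxtrace_mulC.
rewrite !mulmxA; congr (\tr (_ *m _ *m _ *m _)).
by rewrite linearB linearZ /= trmx1 !trmx_mul !trmxK trmx_gram_inv !mulmxA.
Qed.

(** [Pi] and [Pj = J^T Pi J] are the orthogonal projectors to the image of [P] and
    to the orthogonal complement of its kernel.  Since [O^T] has no block from the
    kernel to the kernel, [O^T = Pi O^T + O^T Pj - Pi O^T Pj].  Paired with [B],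
    the first two terms have the same trace, because the symplectic adjoint
    preserves traces, and their sum minus the third is twice the metric. *)
Lemma gSpSt_frob O B : hamiltonian O -> hamiltonian B ->
  (1%:M - P) *m O^T *m (1%:M - P) = 0 ->
  gSpSt U (O *m U) (B *m U) = 2^-1 * frob O B.
Proof.
move=> hO hB QOQ.
pose Pj := J^T *m Pi *m J.
have sPi : sadj Pi = Pj by rewrite /sadj trmx_Pi.
have PiP : (1%:M - Pi) *m P = 0.
  by rewrite mulmxBl mul1mx Pi_rho subrr.
have PPj : P *m (1%:M - Pj) = 0.
  by rewrite mulmxBr mulmx1 -sPi -{2}sadj_rho -sadjM Pi_rho sadj_rho subrr.
have PiQ : (1%:M - Pi) *m (1%:M - P) = 1%:M - Pi.
  by rewrite mulmxBr mulmx1 PiP subr0.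
have QPj : (1%:M - P) *m (1%:M - Pj) = 1%:M - Pj.
  by rewrite mulmxBl mul1mx PPj subr0.
have OT : O^T = Pi *m O^T + O^T *m Pj - Pi *m O^T *m Pj.
  have : (1%:M - Pi) *m O^T *m (1%:M - Pj) = 0.
    rewrite -PiQ -QPj mulmxA -(mulmxA (1%:M - Pi)) -(mulmxA (1%:M - Pi)) QOQ.
    by rewrite mulmx0 mul0mx.
  move=> e; apply/eqP; rewrite -subr_eq0 -[X in _ == X]e; apply/eqP.
  by mxexp; mxlin.
have gE : gSpSt U (O *m U) (B *m U) =
    \tr (O^T *m B *m Pi) - 2^-1 * \tr (O^T *m Pj *m B *m Pi).
  rewrite /gSpSt trmx_mul -!mulmxA mxtrace_mulC !mulmxA.
  rewrite mulmxBr !mulmxBl linearB /= mulmx1 -!scalemxAr -!scalemxAl linearZ /=.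
  by rewrite !mulmxA.
have OBPi : \tr (O^T *m B *m Pi) = \tr (O^T *m Pj *m B).
  rewrite -mxtrace_sadj (sadjM _ Pi) (sadjM O^T) sPi hB sadj_trmx hO linearN /=.
  by rewrite !(mulNmx, mulmxN) opprK mulmxA mxtrace_mulC mulmxA.
rewrite gE /frob {3}OT !(mulmxDl, mulNmx) !mxtraceD linearN /=.
rewrite -OBPi -!(mulmxA Pi) !(mxtrace_mulC Pi) -!mulmxA.
lra.
Qed.

Lemma verSpStP E :
  verSpSt U E <-> exists2 A, hamiltonian A & E = U *m A.
Proof.
split=> [[tE dE]|[A hA ->]].
  move: dE; rewrite derive_rho => dE.
  have hA : hamiltonian (sadj U *m E).
    rewrite /hamiltonian sadjM sadjK; apply/eqP; rewrite -subr_eq0 opprK.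
    by apply/eqP.
  exists (sadj U *m E) => //.
  have : (E *m sadj U + U *m sadj E) *m U = 0 by rewrite dE mul0mx.
  rewrite mulmxDl -mulmxA SpSt_sadj_mul mulmx1 -mulmxA.
  have -> : sadj E *m U = - (sadj U *m E) by rewrite -hA sadjM sadjK.
  by rewrite mulmxN => /eqP; rewrite subr_eq0 => /eqP.
split.
  rewrite /tangentSpSt /= sadjM hA !mulNmx -(mulmxA A) (mulmxA (sadj U)).
  by rewrite SpSt_sadj_mul mulmx1 mul1mx addNr.
by rewrite derive_rho sadjM hA mulNmx mulmxN mulmxA subrr.
Qed.

Lemma vertical_hamiltonian A : hamiltonian A -> hamiltonian (U *m A *m sadj U).
Proof. 
rewrite /hamiltonian => hA; rewrite (sadjM _ (sadj U)) sadjK sadjM hA.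
by rewrite mulNmx mulmxN mulmxA.
Qed.

Lemma vertical_mul (A : 'M[R]_(k + k)) : U *m A *m sadj U *m U = U *m A.
Proof. by rewrite -(mulmxA _ (sadj U)) SpSt_sadj_mul mulmx1. Qed.

Lemma horizontal_horSpSt O : horizontal P O -> horSpSt U (O *m U).
Proof.
move=> hO; have [hamO OT] := hO; split.
  by rewrite /tangentSpSt /= sadjM hamO mulmxN mulNmx mulmxA addNr.
move=> E /verSpStP[A hA ->]; rewrite gSpStC -vertical_mul gSpSt_frob //.
- rewrite (@horizontal_orthogonal _ _ P) ?mulr0 //; first exact: rho_idem.
  by rewrite -mulmxA mul_rho !mulmxA rho_mul.
- exact: vertical_hamiltonian.
- exact: horizontal_coblock rho_idem hO.
Qed.

Lemma Omegabar_mul D : Omegabar U D *m U = D.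
Proof.
have GU : G *m (U^T *m U) = 1%:M by rewrite mulVmx // gram_unit.
rewrite /Omegabar mulmxDl -[RHS]addr0; congr (_ + _).
  by rewrite -!mulmxA GU mulmx1.
rewrite -!mulmxA; set X := (X in D^T *m X); suff -> : X = 0 by rewrite !mulmx0.
rewrite /X mulmxBl mul1mx -!mulmxA (mulmxA J J) Jmx_Jmx mulNmx mul1mx !mulmxN.
by rewrite GU mulmx1 trmx_Jmx mulNmx opprK subrr.
Qed.

(** By the identity [(1 - J^T Pi J) J = J (1 - Pi)]. *)
Lemma OmegabarE D :
  Omegabar U D = D *m G *m U^T + J *m U *m G *m D^T *m J *m (1%:M - Pi).
Proof.
have JPJ : (1%:M - J^T *m U *m G *m U^T *m J) *m J = J *m (1%:M - Pi).
  rewrite mulmxBl mul1mx mulmxBr mulmx1 trmx_Jmx !mulNmx; congr (_ - _).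
  by rewrite -!mulmxA Jmx_Jmx !mulmxN opprK mulmx1.
by rewrite /Omegabar -(mulmxA _ _ J) JPJ !mulmxA.
Qed.

Lemma hamiltonian_Omegabar D : tangentSpSt U D -> hamiltonian (Omegabar U D).
Proof.
rewrite /tangentSpSt /= => tD.
have UJD : U^T *m J *m D = - (D^T *m J *m U).
  apply/eqP; rewrite -subr_eq0 opprK addrC -[X in _ == X](mulmx0 _ (Jmx k)) -tD.
  by rewrite mulmxDr /sadj !mulmxA !Jmx_trmx_Jmx !mul1mx.
rewrite /hamiltonian OmegabarE /sadj linearD /= !trmx_mul linearB /= trmx1.
rewrite !trmxK trmx_Pi trmx_gram_inv mulmxDr mulmxDl !mulmxA.
rewrite -(mulmxA _ J^T J) trmx_Jmx_Jmx mulmx1.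
rewrite mulmxBr mulmx1 !(mulmxBl, mulmxBr) mulmx1 !trmx_Jmx.
rewrite !(mulNmx, mulmxN, opprK) !mulmxA Jmx_Jmx !(mulNmx, mulmxN, mul1mx).
rewrite -(mulmxA _ J D) -(mulmxA _ U^T) (mulmxA U^T) UJD !(mulmxN, mulNmx) !mulmxA.
by mxlin.
Qed.

Lemma trmx_mul_Jmx : U^T *m J = Jmx k *m sadj U.
Proof. by rewrite /sadj !mulmxA Jmx_trmx_Jmx mul1mx. Qed.

Lemma horizontal_Omegabar D : horSpSt U D -> horizontal P (Omegabar U D).
Proof.
move=> [tD oD]; set O := Omegabar U D.
have hO : hamiltonian O by exact: hamiltonian_Omegabar.
have QOQ : (1%:M - P) *m O^T *m (1%:M - P) = 0.
  have QU : (1%:M - P) *m U = 0 by rewrite mulmxBl mul1mx rho_mul subrr.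
  have UJQ : U^T *m J^T *m (1%:M - P) = 0.
    rewrite trmx_Jmx mulmxN mulNmx trmx_mul_Jmx mulmxBr mulmx1 -mulmxA mul_rho.
    by rewrite subrr oppr0.
  move: (1%:M - P) QU UJQ => Q QU UJQ.
  rewrite /O OmegabarE [(_ + _)^T]linearD /= !trmx_mul !trmxK trmx_gram_inv.
  rewrite mulmxDr mulmxDl (mulmxA Q U) QU mul0mx mul0mx add0r.
  by rewrite -!mulmxA (mulmxA U^T) UJQ !mulmx0.
apply: horizontal_blocks => //.
pose W := sadj U *m O^T *m U.
have hW : hamiltonian W.
  rewrite /hamiltonian (sadjM _ U) (sadjM (sadj U)) sadjK sadj_trmx hO.
  by rewrite [(- _)^T]linearN /= mulNmx mulmxN mulmxA.
suff W0 : W = 0.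
  have -> : P *m O^T *m P = U *m W *m sadj U by rewrite /rho /W !mulmxA.
  by rewrite W0 mulmx0 mul0mx.
have hWT := hamiltonian_trmx hW.
have := oD (U *m W^T); rewrite gSpStC -[D]Omegabar_mul -vertical_mul -/O.
rewrite gSpSt_frob //; last exact: vertical_hamiltonian.
move=> /(_ _)/eqP; rewrite mulf_eq0 invr_eq0 pnatr_eq0 /=.
have -> : frob O (U *m W^T *m sadj U) = frob W^T W^T.
  by rewrite /frob trmxK mulmxA mxtrace_mulC !mulmxA.
move=> h; apply: trmx_inj; rewrite trmx0; apply/frob_eq0/eqP/h.
by rewrite vertical_mul; apply/verSpStP; exists W^T.
Qed.

End StiefelMetric.

Section GrassmannMetric.
Context {R : realType} {n k : nat}.
Implicit Types (P O L B Z : 'M[R]_(n + n)).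

(** The difference of the two matrices is horizontal and commutes with [P], hence
    is orthogonal to itself.  For this reason the value of the metric does not
    depend on the representative [U] of [P]. *)
Lemma horizontal_inj P O L : P *m P = P -> horizontal P O -> horizontal P L ->
  O *m P - P *m O = L *m P - P *m L -> O = L.
Proof.
move=> PP hO hL OL; apply/eqP; rewrite -subr_eq0; apply/eqP.
have ZP : (O - L) *m P = P *m (O - L).
  apply/eqP; rewrite -subr_eq0; move: OL => /eqP; rewrite -subr_eq0 => /eqP <-.
  by apply/eqP; mxexp; mxlin.
apply: frob_eq0; rewrite frobBl.
by rewrite (horizontal_orthogonal PP hO ZP) (horizontal_orthogonal PP hL ZP) subrr.
Qed.

Lemma gSpGr_frob P O : SpGr k P -> horizontal P O ->
  gSpGr k P (O *m P - P *m O) (O *m P - P *m O) = 2^-1 * frob O O.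
Proof.
move=> PSp hO; have [PP _ _] := PSp; rewrite /gSpGr.
set S := (X in get X).
have SE x : S x -> x = 2^-1 * frob O O.
  case=> U [D1 [D2 [[USp UP] [hD1 dD1] [hD2 dD2] ->]]].
  have lift D : horSpSt U D -> 'D_D (@rho R n k) U = O *m P - P *m O ->
      D = O *m U.
    move=> hD dD; have hOD := horizontal_Omegabar USp hD.
    rewrite -[LHS](Omegabar_mul USp); congr (_ *m _).
    rewrite UP in hOD; apply: (horizontal_inj PP hOD hO).
    by rewrite -dD -{3}(Omegabar_mul USp D) derive_rho_mul ?UP //; case: hOD.
  rewrite (lift _ hD1 dD1) (lift _ hD2 dD2) gSpSt_frob //; case: (hO) => //.
  by rewrite UP => ? _; exact: horizontal_coblock.
have [U USp UP] := rho_surjective PSp.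
apply: SE; apply: getPex; exists (gSpSt U (O *m U) (O *m U)).
have hOU : horSpSt U (O *m U) by apply: horizontal_horSpSt; rewrite ?UP.
have dOU : 'D_(O *m U) (@rho R n k) U = O *m P - P *m O.
  by rewrite derive_rho_mul ?UP //; case: hO.
by exists U, (O *m U), (O *m U).
Qed.

(** Let [O] be horizontal with the same commutator as [L].  Then [L - O] commutes
    with [P], so [|L|^2 = |O|^2 + |L - O|^2] and [<B, L> = <B, O>]; the lower bound
    is [|O - B|^2 >= 0].  Unlike [O], the competitors [L] and [B] can be chosen to
    depend polynomially on [P] and on the tangent vector. *)
Lemma gSpGr_bounds P L B (X := L *m P - P *m L) :
  SpGr k P -> hamiltonian L -> horizontal P B ->
  frob B L - 2^-1 * frob B B <= gSpGr k P X X <= 2^-1 * frob L L.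
Proof.
move=> PSp hL hB; have [PP _ sP] := PSp.
case: (horizontal_exists PP sP hL) => O hO OL.
have ZP : (L - O) *m P = P *m (L - O).
  apply/eqP; rewrite -subr_eq0; move: OL => /eqP; rewrite -subr_eq0 => /eqP OL.
  by rewrite -oppr_eq0 -[X in _ == X]OL; apply/eqP; mxexp; mxlin.
rewrite /X -OL gSpGr_frob //.
have := horizontal_orthogonal PP hO ZP.
have := horizontal_orthogonal PP hB ZP.
rewrite !frobBr => BL OO.
have := frob_ge0 (B - O).
have := frob_ge0 (L - O).
rewrite !(frobBl, frobBr) (frobC O L) (frobC O B) => h1 h2.
rewrite (frobC L O) in h1.
by apply/andP; split; lra.
Qed.

End GrassmannMetric.

(** * Derivatives of integrals *)

Section IntegralDerivative.
Context {R : realType}.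
Notation mu := (@lebesgue_measure R).
Implicit Types (a b s t : R).

(** The integral of a nonnegative function is a supremum over the simple functions
    below it, which makes it monotone without any measurability.  This is how
    integrands without an explicit form, such as the metric along a variation, are
    compared with explicit ones. *)
Lemma ge0_le_integral_nonmeasurable d (T : measurableType d)
    (nu : {measure set T -> \bar R}) (D : set T) (f g : T -> \bar R) :
  (forall x, D x -> 0 <= f x)%E -> (forall x, D x -> f x <= g x)%E ->
  (\int[nu]_(x in D) f x <= \int[nu]_(x in D) g x)%E.
Proof.
move=> f0 fg; rewrite !ge0_integralE // => [|x Dx]; last first.
  exact: le_trans (f0 _ Dx) (fg _ Dx).
apply: ereal_sup_le => _ [h hf <-]; exists h => // x.
apply: le_trans (hf x) _; rewrite /patch; case: ifPn => // /set_mem.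
exact: fg.
Qed.

Lemma continuous_integrable (f : R -> R) a b :
  continuous f -> mu.-integrable `[a, b] (EFin \o f).
Proof.
move=> cf; apply: continuous_compact_integrable; first exact: segment_compact.
exact: continuous_subspaceT.
Qed.

Lemma Rintegral_squeeze (lo q hi : R -> R) a b :
  continuous lo -> continuous hi ->
  (forall t, a <= t <= b -> 0 <= q t) ->
  (forall t, a <= t <= b -> lo t <= q t <= hi t) ->
  \int[mu]_(t in `[a, b]) lo t <= \int[mu]_(t in `[a, b]) q t
    <= \int[mu]_(t in `[a, b]) hi t.
Proof.
move=> clo chi q0 loqhi.
have ab t : `[a, b]%classic t -> a <= t <= b by rewrite /= in_itv.
(* Monotonicity needs nonnegative integrands, so [lo] is truncated at [0]. *)
pose lo0 t := Num.max (lo t) 0.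
have clo0 : continuous lo0.
  by move=> t; apply: continuous_max; [exact: clo|exact: cst_continuous].
have ilo0 := @continuous_integrable lo0 a b clo0.
have ihi := @continuous_integrable hi a b chi.
have qhi : (\int[mu]_(t in `[a, b]) (q t)%:E <=
            \int[mu]_(t in `[a, b]) (hi t)%:E)%E.
  apply: ge0_le_integral_nonmeasurable => t /ab tab; rewrite lee_fin ?q0 //.
  by have /andP[] := loqhi t tab.
have lo0q : (\int[mu]_(t in `[a, b]) (lo0 t)%:E <=
             \int[mu]_(t in `[a, b]) (q t)%:E)%E.
  apply: ge0_le_integral_nonmeasurable => t /ab tab; rewrite lee_fin.
    by rewrite /lo0 le_max lexx orbT.
  by rewrite /lo0 ge_max q0 // andbT; have /andP[] := loqhi t tab.
have hifin : (\int[mu]_(t in `[a, b]) (hi t)%:E)%E \is a fin_num.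
  by apply: integrable_fin_num; [exact: measurable_itv|exact: ihi].
have lo0fin : (\int[mu]_(t in `[a, b]) (lo0 t)%:E)%E \is a fin_num.
  by apply: integrable_fin_num; [exact: measurable_itv|exact: ilo0].
have qfin : (\int[mu]_(t in `[a, b]) (q t)%:E)%E \is a fin_num.
  rewrite fin_numElt (lt_le_trans _ lo0q) ?(le_lt_trans qhi) //.
    by rewrite ltey_eq hifin.
  by rewrite ltNye_eq lo0fin.
apply/andP; split; last by rewrite /Rintegral fine_le.
apply: (@le_trans _ _ (\int[mu]_(t in `[a, b]) lo0 t)).
  apply: le_Rintegral => //; first exact: continuous_integrable.
  by move=> t _; rewrite /lo0 le_max lexx.
by rewrite /Rintegral fine_le.
Qed.

Lemma is_deriveP (V W : normedModType R) (f : V -> W) x v l :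
  is_derive x v f l <-> h^-1 *: (f (h *: v + x) - f x) @[h --> 0^'] --> l.
Proof.
split=> [df|df]; last by apply: DeriveDef; [exact: cvgP df|exact: cvg_lim df].
by rewrite -(@derive_val _ _ _ _ _ _ _ df); exact: (@ex_derive _ _ _ _ _ _ _ df).
Qed.

Lemma is_derive_squeeze (lo f hi : R -> R) (e l : R) : 0 < e ->
  (forall s, - e < s < e -> lo s <= f s <= hi s) -> lo 0 = hi 0 ->
  is_derive (0 : R) (1 : R) lo l -> is_derive (0 : R) (1 : R) hi l ->
  is_derive (0 : R) (1 : R) f l.
Proof.
move=> e0 lfh lh0 /is_deriveP/cvgrPdist_le dlo /is_deriveP/cvgrPdist_le dhi.
have f0 : f 0 = lo 0.
  apply/eqP; rewrite eq_le {1}lh0.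
  have /andP[lf0 fh0] : lo 0 <= f 0 <= hi 0 by apply: lfh; rewrite oppr_lt0 e0.
  by rewrite fh0 lf0.
apply/is_deriveP/cvgrPdist_le => d d0; near=> h.
have lo_h : `|l - h^-1 *: (lo (h *: 1 + 0) - lo 0)| <= d by near: h; exact: dlo.
have hi_h : `|l - h^-1 *: (hi (h *: 1 + 0) - hi 0)| <= d by near: h; exact: dhi.
have he : `|h| < e by near: h; exact: dnbhs0_lt.
have h0 : h != 0 by near: h; exact: nbhs_dnbhs_neq.
have := lfh h; rewrite -ltr_norml => /(_ he).
rewrite /GRing.scale /= mulr1 !addr0 -lh0 -f0 in lo_h hi_h *.
move: lo_h hi_h; rewrite !ler_norml => /andP[lo1 lo2] /andP[hi1 hi2] /andP[lf fh].
have [h_gt0|h_lt0|/eqP] := ltgtP 0 h; last by rewrite eq_sym (negPf h0).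
  have hi_gt0 : 0 < h^-1 by rewrite invr_gt0.
  have : h^-1 * (lo h - f 0) <= h^-1 * (f h - f 0) <= h^-1 * (hi h - f 0).
    by rewrite !ler_pM2l // !lerD2r lf fh.
  by move=> /andP[? ?]; apply/andP; split; lra.
have hi_lt0 : h^-1 < 0 by rewrite invr_lt0.
have : h^-1 * (hi h - f 0) <= h^-1 * (f h - f 0) <= h^-1 * (lo h - f 0).
  by rewrite !ler_nM2l // !lerD2r lf fh.
by move=> /andP[? ?]; apply/andP; split; lra.
Unshelve. all: by end_near. Qed.

Lemma continuous_slice (V : topologicalType) (f : R -> R -> V) s :
  continuous (fun p : R * R => f p.1 p.2) -> continuous (f s).
Proof.
move=> cf t; apply: (@continuous2_cvg _ _ _ _ (nbhs t) _ (cst s) id f s t).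
- exact: (cf (s, t)).
- exact: cvg_cst.
- exact: cvg_id.
Qed.

Lemma is_derive_integral (f df : R -> R -> R) a b : a <= b ->
  continuous (fun p : R * R => f p.1 p.2) ->
  continuous (fun p : R * R => df p.1 p.2) ->
  (forall s t, is_derive s (1 : R) (f ^~ t) (df s t)) ->
  is_derive (0 : R) (1 : R) (fun s => \int[mu]_(t in `[a, b]) f s t)
    (\int[mu]_(t in `[a, b]) df 0 t).
Proof.
move=> ab cf cdf dfE.
pose K := (`[-1, 1] `*` `[a, b] : set (R * R)).
have cK : compact K by apply: compact_setX; exact: segment_compact.
have K0 : K !=set0.
  by exists (0, a); split; rewrite /= in_itv /= ?lexx // ler01 oppr_le0 ler01.
have cn : continuous (fun p : R * R => `|df p.1 p.2|).
  by move=> p; apply: continuous_comp; [exact: cdf|exact: norm_continuous].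
have [c _ cmax] := compact_EVT_max K0 cK (continuous_subspaceT cn).
have mab := measurable_itv `[a, b].
have I0 : `]-1, 1[%classic (0 : R) by rewrite /= in_itv /= ltr01 oppr_lt0 ltr01.
have intf (s : R) : `]-1, 1[%classic s -> mu.-integrable `[a, b] (EFin \o f s).
  by move=> _; exact/continuous_integrable/continuous_slice.
have derf (s t : R) : `]-1, 1[%classic s -> `[a, b]%classic t ->
    derivable (f ^~ t) s 1 by move=> _ _.
have G0 (t : R) : 0 <= cst `|df c.1 c.2| t by exact: normr_ge0.
have intG : mu.-integrable `[a, b] (EFin \o cst `|df c.1 c.2|).
  by apply: continuous_integrable; exact: cst_continuous.
have partE s t : partial1of2 f s t = df s t.
  by rewrite partial1of2E; have d := dfE s t; rewrite derive_val.
have Gub (s t : R) : `]-1, 1[%classic s -> `[a, b]%classic t ->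
    `|partial1of2 f s t| <= cst `|df c.1 c.2| t.
  move=> /= s1 tab; rewrite partE; apply: (cmax (s, t)); rewrite inE; split=> //=.
  by move: s1; rewrite !in_itv /= => /andP[/ltW -> /ltW ->].
apply: DeriveDef.
  exact: (@derivable_under_integral _ _ _ mu f _ mab _ _ _ I0 intf derf _ G0 intG).
rewrite -derive1E.
rewrite (@differentiation_under_integral _ _ _ mu f _ mab _ _ _
  I0 intf derf _ G0 intG) //.
by apply: eq_Rintegral => t _; rewrite partE.
Qed.

End IntegralDerivative.

(** * First variation of the energy *)

Section DerivativeOnInterval.
Context {R : realType} {V : normedModType R}.

(** At an endpoint the derivative is also a one-sided limit of difference
    quotients, and these vanish. *)
Lemma is_derive_cst_on (f : R -> V) (w : V) a b t l : a < b -> a <= t <= b ->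
  (forall x, a <= x <= b -> f x = w) -> is_derive t (1 : R) f l -> l = 0.
Proof.
move=> ab /andP[at_ tb] fw /is_deriveP df.
have ft : f t = w by apply: fw; rewrite at_ tb.
have [tb'|bt] := ltP t b.
  have /cvg_lim <- // := cvg_dnbhs_at_right df.
  apply: cvg_lim => //; apply: cvg_near_cst; near=> h.
  have h0 : 0 < h by near: h; exact: nbhs_right_gt.
  have hb : h <= b - t by near: h; apply: nbhs_right_le; rewrite subr_gt0.
  rewrite ft fw ?subrr ?scaler0 // /GRing.scale /= mulr1.
  by apply/andP; split; lra.
have /cvg_lim <- // := cvg_dnbhs_at_left df.
apply: cvg_lim => //; apply: cvg_near_cst; near=> h.
have h0 : h < 0 by near: h; exact: nbhs_left_lt.
have hb : a - t <= h by near: h; apply: nbhs_left_ge; lra.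
rewrite ft fw ?subrr ?scaler0 // /GRing.scale /= mulr1.
by apply/andP; split; lra.
Unshelve. all: by end_near. Qed.

Lemma is_derive_eq_on (f g : R -> V) a b t f' g' : a < b -> a <= t <= b ->
  (forall x, a <= x <= b -> f x = g x) ->
  is_derive t (1 : R) f f' -> is_derive t (1 : R) g g' -> f' = g'.
Proof.
move=> ab tab fg df dg; apply/eqP; rewrite -subr_eq0; apply/eqP.
apply: (is_derive_cst_on ab tab _ (is_deriveB df dg)) => x xab.
by rewrite !fctE fg // subrr.
Qed.

End DerivativeOnInterval.

Section LiftsAlongVariation.
Context {R : realType} {n : nat}.
Implicit Types (P X O : 'M[R]_(n + n)).

(** The first two terms form a matrix with commutator [X] with the projector [P];
    the diagonal part of [O] is added so that [O] itself is recovered when [X] is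
    its commutator with [P]. *)
Definition hamiltonian_lift P X O := X *m P - P *m X + diag_part P O.

(** The component of [O] in the horizontal matrices along the matrices whose
    transpose commutes with [P]; unlike the orthogonal projection, it is
    polynomial in [P]. *)
Definition horizontal_part P O := (O^T - diag_part P O^T)^T.

Lemma hamiltonian_hamiltonian_lift P X O :
  sadj P = P -> sadj X = X -> hamiltonian O -> hamiltonian (hamiltonian_lift P X O).
Proof.
move=> sP sX hO; apply: hamiltonianD; first exact: hamiltonian_commutator.
exact: hamiltonian_diag_part.
Qed.

Lemma hamiltonian_lift_commutator P X O : P *m P = P -> X = P *m X + X *m P ->
  hamiltonian_lift P X O *m P - P *m hamiltonian_lift P X O = X.
Proof.
move=> PP XE; have PXP : P *m X *m P = 0.
  have : P *m X *m P = P *m X *m P + P *m X *m P.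
    by rewrite {1}XE mulmxDr mulmxDl !mulmxA PP -!mulmxA PP.
  by move/eqP; rewrite -subr_eq0 opprD addrA subrr sub0r oppr_eq0 => /eqP.
rewrite /hamiltonian_lift mulmxDl mulmxDr diag_part_comm //; mxexp.
by rewrite !(idempotent_mulmxr PP, PP, PXP) [RHS]XE; mxlin.
Qed.

Lemma horizontal_horizontal_part P O : P *m P = P -> sadj P = P ->
  hamiltonian O -> horizontal P (horizontal_part P O).
Proof.
move=> PP sP hO; have hOT := hamiltonian_trmx hO; split.
  apply/hamiltonian_trmx/hamiltonianD => //.
  exact/hamiltonianN/hamiltonian_diag_part.
rewrite trmxK /diag_part; mxexp.
by rewrite !(idempotent_mulmxr PP, PP); mxlin.
Qed.

Lemma hamiltonian_lift_id P O : P *m P = P ->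
  hamiltonian_lift P (O *m P - P *m O) O = O.
Proof.
move=> PP; rewrite /hamiltonian_lift /diag_part; mxexp.
by rewrite !(idempotent_mulmxr PP, PP); mxlin.
Qed.

Lemma horizontal_part_id P O : P *m P = P -> horizontal P O ->
  horizontal_part P O = O.
Proof.
move=> PP hO; rewrite /horizontal_part /diag_part.
by rewrite (horizontal_block PP hO) (horizontal_coblock PP hO) addr0 subr0 trmxK.
Qed.

(** The formal derivatives of these matrices when [P] and [X] move with
    velocities [P'] and [X']. *)
Definition d_diag_part P O P' :=
  P' *m O *m P + P *m O *m P'
  - P' *m O *m (1%:M - P) - (1%:M - P) *m O *m P'.

Definition d_hamiltonian_lift P X O P' X' :=
  X' *m P + X *m P' - P' *m X - P *m X' + d_diag_part P O P'.

Definition d_horizontal_part P O P' := - (d_diag_part P O^T P')^T.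

Lemma is_derive_diag_part (P : R -> 'M[R]_(n + n)) O P' s :
  is_derive s (1 : R) P P' ->
  is_derive s (1 : R) (fun s => diag_part (P s) O) (d_diag_part (P s) O P').
Proof.
move=> dP; have dQ := is_deriveB (is_derive_cst (1%:M : 'M[R]_(n + n)) s (1 : R)) dP.
have d1 := is_derive_mulmx (is_derive_mulmxr O dP) dP.
have d2 := is_derive_mulmx (is_derive_mulmxr O dQ) dQ.
apply: is_derive_eq (is_deriveD d1 d2) _.
by rewrite !fctE /d_diag_part !sub0r !(mulNmx, mulmxN) addrA.
Qed.

Lemma is_derive_hamiltonian_lift (P X : R -> 'M[R]_(n + n)) O P' X' s :
  is_derive s (1 : R) P P' -> is_derive s (1 : R) X X' ->
  is_derive s (1 : R) (fun s => hamiltonian_lift (P s) (X s) O)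
    (d_hamiltonian_lift (P s) (X s) O P' X').
Proof.
move=> dP dX.
have dC := is_deriveB (is_derive_mulmx dX dP) (is_derive_mulmx dP dX).
apply: is_derive_eq (is_deriveD dC (is_derive_diag_part O dP)) _.
by rewrite /d_hamiltonian_lift; congr (_ + _); rewrite opprD !addrA.
Qed.

Lemma is_derive_horizontal_part (P : R -> 'M[R]_(n + n)) O P' s :
  is_derive s (1 : R) P P' ->
  is_derive s (1 : R) (fun s => horizontal_part (P s) O)
    (d_horizontal_part (P s) O P').
Proof.
move=> dP.
have d := is_deriveB (is_derive_cst O^T s (1 : R)) (is_derive_diag_part O^T dP).
apply: is_derive_eq (is_derive_trmx d) _.
by rewrite sub0r; apply/matrixP => i j; rewrite !mxE.
Qed.

(** For a two-parameter family of projectors with velocities [X] in [t] and [P'] in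
    [s], and with [X'] the mixed derivative, the first parenthesis is the
    derivative of [A] in [t]: this is the zero-curvature equation that relates the
    derivative of the lift of [X] in [s] to that of [A] in [t]. *)
Lemma d_hamiltonian_liftE P O P' X' (X := O *m P - P *m O)
    (A := P' *m P - P *m P') : P' = P' *m P + P *m P' ->
  d_hamiltonian_lift P X O P' X' =
  (X' *m P + P' *m X - X *m P' - P *m X') + (A *m O - O *m A).
Proof.
move=> P'E; rewrite /d_hamiltonian_lift /d_diag_part.
have eO : O *m P' *m P + O *m P *m P' - O *m P' = 0.
  by rewrite {3}P'E mulmxDr !mulmxA subrr.
have e'O : P' *m P *m O + P *m P' *m O - P' *m O = 0.
  by rewrite {3}P'E mulmxDl subrr.
rewrite -[RHS]addr0 -[X in _ = _ + X]addr0 -{1}eO -e'O /A /X.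
by mxexp; mxlin.
Qed.

Lemma frob_commutator O A :
  frob O (A *m O - O *m A) = frob (O *m O^T - O^T *m O) A.
Proof.
rewrite frobBr frobBl /frob !trmx_mul trmxK; congr (_ - _).
  by rewrite mulmxA mxtrace_mulC mulmxA.
by rewrite mulmxA.
Qed.

End LiftsAlongVariation.

Section LiftsContinuity.
Context {R : realType} {n : nat} {T : topologicalType}.
Variables P X O P' X' : T -> 'M[R]_(n + n).
Hypothesis cP : continuous P.
Hypothesis cX : continuous X.
Hypothesis cO : continuous O.
Hypothesis cP' : continuous P'.
Hypothesis cX' : continuous X'.

Let cQ : continuous (fun x => 1%:M - P x).
Proof. exact: continuous_submx (@cst_continuous _ _ _) cP. Qed.

Lemma continuous_diag_part : continuous (fun x => diag_part (P x) (O x)).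
Proof.
exact: continuous_addmx (continuous_mulmx (continuous_mulmx cP cO) cP)
  (continuous_mulmx (continuous_mulmx cQ cO) cQ).
Qed.

Lemma continuous_d_diag_part :
  continuous (fun x => d_diag_part (P x) (O x) (P' x)).
Proof.
exact: continuous_submx
  (continuous_submx
    (continuous_addmx (continuous_mulmx (continuous_mulmx cP' cO) cP)
      (continuous_mulmx (continuous_mulmx cP cO) cP'))
    (continuous_mulmx (continuous_mulmx cP' cO) cQ))
  (continuous_mulmx (continuous_mulmx cQ cO) cP').
Qed.

Lemma continuous_hamiltonian_lift :
  continuous (fun x => hamiltonian_lift (P x) (X x) (O x)).
Proof.
exact: continuous_addmx
  (continuous_submx (continuous_mulmx cX cP) (continuous_mulmx cP cX))
  continuous_diag_part.
Qed.

Lemma continuous_d_hamiltonian_lift :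
  continuous (fun x => d_hamiltonian_lift (P x) (X x) (O x) (P' x) (X' x)).
Proof.
exact: continuous_addmx
  (continuous_submx
    (continuous_submx
      (continuous_addmx (continuous_mulmx cX' cP) (continuous_mulmx cX cP'))
      (continuous_mulmx cP' cX))
    (continuous_mulmx cP cX'))
  continuous_d_diag_part.
Qed.

End LiftsContinuity.

Section HorizontalPartContinuity.
Context {R : realType} {n : nat} {T : topologicalType}.
Variables P O P' : T -> 'M[R]_(n + n).
Hypothesis cP : continuous P.
Hypothesis cO : continuous O.
Hypothesis cP' : continuous P'.

Lemma continuous_horizontal_part :
  continuous (fun x => horizontal_part (P x) (O x)).
Proof.
have cOT := continuous_trmx cO.
exact: continuous_trmx (continuous_submx cOT (continuous_diag_part cP cOT)).
Qed.

Lemma continuous_d_horizontal_part :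
  continuous (fun x => d_horizontal_part (P x) (O x) (P' x)).
Proof.
have cOT := continuous_trmx cO => x; apply: cvgN.
exact: (continuous_trmx (continuous_d_diag_part cP cOT cP')).
Qed.

End HorizontalPartContinuity.

Lemma gSpGr_ge0 {R : realType} {n k : nat} (P X : 'M[R]_(n + n)) :
  SpGr k P -> X = P *m X + X *m P -> sadj X = X ->
  0 <= gSpGr k P X X :> R.
Proof.
move=> PSp XE sX; have [PP _ sP] := PSp.
have h0 : hamiltonian (0 : 'M[R]_(n + n)).
  by rewrite /hamiltonian /sadj trmx0 mulmx0 mul0mx oppr0.
have hz0 : horizontal P 0 by split=> //; rewrite trmx0 mulmx0 mul0mx addr0.
have hL := hamiltonian_hamiltonian_lift sP sX h0.
have := gSpGr_bounds PSp hL hz0.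
rewrite hamiltonian_lift_commutator // => /andP[+ _].
by rewrite /frob trmx0 !mul0mx mxtrace0 mulr0 subr0.
Qed.

Section FirstVariation.
Context {R : realType} {n k : nat}.
Variables gamma O : R -> 'M[R]_(n + n).
Hypothesis gammaSp : forall t, SpGr k (gamma t).
Hypothesis O_hor : forall t, horizontal (gamma t) (O t).
Hypothesis dgamma : forall t,
  is_derive t (1 : R) gamma (O t *m gamma t - gamma t *m O t).
Hypothesis dO : forall t,
  is_derive t (1 : R) O (O t *m (O t)^T - (O t)^T *m O t).

Notation mu := (@lebesgue_measure R).

Section WithVariation.
Variables (a b e : R) (D : nat -> nat -> R -> R -> 'M[R]_(n + n)).
Hypothesis ab : a < b.
Hypothesis e_gt0 : 0 < e.
Hypothesis cD : forall i j, continuous (fun p : R * R => D i j p.1 p.2).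
Hypothesis D_ds : forall i j s t, is_derive s (1 : R) (D i j ^~ t) (D i.+1 j s t).
Hypothesis D_dt : forall i j s t, is_derive t (1 : R) (D i j s) (D i j.+1 s t).
Hypothesis D_SpGr : forall s t, - e < s < e -> a <= t <= b -> SpGr k (D 0 0 s t).
Hypothesis D_gamma : forall t, a <= t <= b -> D 0 0 0 t = gamma t.
Hypothesis D_ends : forall s, - e < s < e ->
  D 0 0 s a = gamma a /\ D 0 0 s b = gamma b.

Local Notation F := (D 0 0).
Local Notation Fs := (D 1 0).
Local Notation Ft := (D 0 1).
Local Notation Fst := (D 1 1).

(* [L] generates the velocity of the variation and [B] is horizontal along it;
   both are equal to [O] for [s = 0], where the bounds [lo] and [hi] of the metric
   therefore agree to first order. *)
Let L s t := hamiltonian_lift (F s t) (Ft s t) (O t).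
Let B s t := horizontal_part (F s t) (O t).
Let dL s t := d_hamiltonian_lift (F s t) (Ft s t) (O t) (Fs s t) (Fst s t).
Let dB s t := d_horizontal_part (F s t) (O t) (Fs s t).

Let hi s t := 2^-1 * frob (L s t) (L s t).
Let lo s t := frob (B s t) (L s t) - 2^-1 * frob (B s t) (B s t).
Let dhi s t := 2^-1 * (frob (dL s t) (L s t) + frob (L s t) (dL s t)).
Let dlo s t := frob (dB s t) (L s t) + frob (B s t) (dL s t)
  - 2^-1 * (frob (dB s t) (B s t) + frob (B s t) (dB s t)).

Lemma D_tangent_t s t : - e < s < e -> a <= t <= b ->
  Ft s t = F s t *m Ft s t + Ft s t *m F s t /\ sadj (Ft s t) = Ft s t.
Proof.
move=> se tab; have dt := D_dt 0 0 s t; split; apply/esym.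
  rewrite addrC; apply: (is_derive_eq_on ab tab _ (is_derive_mulmx dt dt) dt).
  by move=> x xab; have [-> _ _] := D_SpGr se xab.
apply: (is_derive_eq_on ab tab _ dt (is_derive_sadj dt)).
by move=> x xab; have [_ _ ->] := D_SpGr se xab.
Qed.

Lemma D_tangent_s t : a <= t <= b ->
  Fs 0 t = Fs 0 t *m F 0 t + F 0 t *m Fs 0 t.
Proof.
move=> tab; have ds := D_ds 0 0 0 t; apply/esym.
have e2 : - (e / 2) < e / 2 by have := e_gt0; lra.
apply: (is_derive_eq_on e2 _ _ (is_derive_mulmx ds ds) ds).
  by have := e_gt0; lra.
move=> x xe; have xe' : - e < x < e by have := e_gt0; lra.
by have [-> _ _] := D_SpGr xe' tab.
Qed.

Lemma D_s_end t : t = a \/ t = b -> Fs 0 t = 0.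
Proof.
move=> tab; have e2 : - (e / 2) < e / 2 by have := e_gt0; lra.
apply: (is_derive_cst_on e2 _ (w := gamma t) _ (D_ds 0 0 0 t)).
  by have := e_gt0; lra.
move=> x xe; have xe' : - e < x < e by have := e_gt0; lra.
by case: tab => ->; have [] := D_ends xe'.
Qed.

Lemma D_t_start t : a <= t <= b -> Ft 0 t = O t *m gamma t - gamma t *m O t.
Proof.
move=> tab.
exact: is_derive_eq_on ab tab D_gamma (D_dt 0 0 0 t) (dgamma t).
Qed.

Lemma L_start t : a <= t <= b -> L 0 t = O t.
Proof.
move=> tab; rewrite /L D_t_start // D_gamma // hamiltonian_lift_id //.
by have [] := gammaSp t.
Qed.

Lemma B_start t : a <= t <= b -> B 0 t = O t.
Proof.
move=> tab; rewrite /B D_gamma // horizontal_part_id //.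
by have [] := gammaSp t.
Qed.

Let g s t := gSpGr k (F s t) (Ft s t) (Ft s t).

Lemma g_bounds s t : - e < s < e -> a <= t <= b -> lo s t <= g s t <= hi s t.
Proof.
move=> se tab; have [XE sX] := D_tangent_t se tab.
have FSp := D_SpGr se tab; have [PP _ sP] := FSp.
have [hO _] := O_hor t.
have := gSpGr_bounds FSp (hamiltonian_hamiltonian_lift sP sX hO)
  (horizontal_horizontal_part PP sP hO).
by rewrite hamiltonian_lift_commutator.
Qed.

Lemma g_ge0 s t : - e < s < e -> a <= t <= b -> 0 <= g s t.
Proof.
move=> se tab; have [XE sX] := D_tangent_t se tab.
exact: gSpGr_ge0 (D_SpGr se tab) XE sX.
Qed.

Lemma is_derive_L s t : is_derive s (1 : R) (L ^~ t) (dL s t).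
Proof. exact: is_derive_hamiltonian_lift (D_ds 0 0 s t) (D_ds 0 1 s t). Qed.

Lemma is_derive_B s t : is_derive s (1 : R) (B ^~ t) (dB s t).
Proof. exact: is_derive_horizontal_part (D_ds 0 0 s t). Qed.

Lemma is_derive_hi s t : is_derive s (1 : R) (hi ^~ t) (dhi s t).
Proof.
exact: is_deriveZ (is_derive_frob (is_derive_L s t) (is_derive_L s t)).
Qed.

Lemma is_derive_lo s t : is_derive s (1 : R) (lo ^~ t) (dlo s t).
Proof.
have dBB := is_derive_frob (is_derive_B s t) (is_derive_B s t).
exact: is_deriveB (is_derive_frob (is_derive_B s t) (is_derive_L s t))
  (is_deriveZ 2^-1 dBB).
Qed.

Let cO : continuous (fun p : R * R => O p.2).
Proof.
move=> p; apply: (@continuous_comp _ _ _ (fun p : R * R => p.2) O).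
  exact: cvg_snd.
exact: (is_derive_continuous dO).
Qed.

Let continuous_L : continuous (fun p : R * R => L p.1 p.2).
Proof. rewrite /L; exact: (continuous_hamiltonian_lift (@cD 0 0) (@cD 0 1) cO). Qed.

Let continuous_B : continuous (fun p : R * R => B p.1 p.2).
Proof. rewrite /B; exact: (continuous_horizontal_part (@cD 0 0) cO). Qed.

Let continuous_dL : continuous (fun p : R * R => dL p.1 p.2).
Proof.
rewrite /dL; exact: (continuous_d_hamiltonian_lift
  (@cD 0 0) (@cD 0 1) cO (@cD 1 0) (@cD 1 1)).
Qed.

Let continuous_dB : continuous (fun p : R * R => dB p.1 p.2).
Proof. rewrite /dB; exact: (continuous_d_horizontal_part (@cD 0 0) cO (@cD 1 0)). Qed.

Let continuous_hi : continuous (fun p : R * R => hi p.1 p.2).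
Proof.
move=> p; apply: cvgM; first exact: cvg_cst.
exact: (continuous_frob continuous_L continuous_L).
Qed.

Let continuous_lo : continuous (fun p : R * R => lo p.1 p.2).
Proof.
move=> p; apply: cvgB; first exact: (continuous_frob continuous_B continuous_L).
by apply: cvgM; [exact: cvg_cst|exact: (continuous_frob continuous_B continuous_B)].
Qed.

Let continuous_dhi : continuous (fun p : R * R => dhi p.1 p.2).
Proof.
move=> p; apply: cvgM; first exact: cvg_cst.
apply: cvgD; first exact: (continuous_frob continuous_dL continuous_L).
exact: (continuous_frob continuous_L continuous_dL).
Qed.

Let continuous_dlo : continuous (fun p : R * R => dlo p.1 p.2).
Proof.
move=> p; apply: cvgB.
  apply: cvgD; first exact: (continuous_frob continuous_dB continuous_L).
  exact: (continuous_frob continuous_B continuous_dL).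
apply: cvgM; first exact: cvg_cst.
apply: cvgD; first exact: (continuous_frob continuous_dB continuous_B).
exact: (continuous_frob continuous_B continuous_dB).
Qed.

(* The infinitesimal conjugation that generates the variation field. *)
Let A t := Fs 0 t *m F 0 t - F 0 t *m Fs 0 t.
Let dA t := Fst 0 t *m F 0 t + Fs 0 t *m Ft 0 t
  - Ft 0 t *m Fs 0 t - F 0 t *m Fst 0 t.
Let dOt t := O t *m (O t)^T - (O t)^T *m O t.

Lemma is_derive_frob_A t : is_derive t (1 : R) (fun t => frob (O t) (A t))
  (frob (dOt t) (A t) + frob (O t) (dA t)).
Proof.
have dF := D_dt 0 0 0 t; have dFs := D_dt 1 0 0 t.
have dAt : is_derive t (1 : R) A (dA t).
  apply: is_derive_eq (is_deriveB (is_derive_mulmx dFs dF) (is_derive_mulmx dF dFs)) _.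
  by rewrite /dA opprD !addrA.
exact: is_derive_frob (dO t) dAt.
Qed.

Lemma frob_dL_start t : a <= t <= b ->
  frob (O t) (dL 0 t) = frob (dOt t) (A t) + frob (O t) (dA t).
Proof.
move=> tab; rewrite /dL D_t_start // -(D_gamma tab).
rewrite d_hamiltonian_liftE; last exact: D_tangent_s.
rewrite frobDr frob_commutator addrC; congr (_ + frob _ _).
by rewrite /dA D_t_start // D_gamma.
Qed.

(** The integrand is the derivative of [<O, A>], since [O' = O O^T - O^T O] and
    [<O, A O - O A> = <O O^T - O^T O, A>]; the boundary terms vanish because the
    variation has fixed ends. *)
Lemma integral_dL_start : \int[mu]_(t in `[a, b]) frob (O t) (dL 0 t) = 0.
Proof.
pose phi t := frob (O t) (A t).
pose dphi t := frob (dOt t) (A t) + frob (O t) (dA t).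
have cD0 i j : continuous (D i j 0) by exact: continuous_slice (@cD i j).
have cOt : continuous O by exact: is_derive_continuous dO.
have cOT := continuous_trmx cOt.
have cA : continuous A.
  exact: continuous_submx (continuous_mulmx (cD0 1 0) (cD0 0 0))
    (continuous_mulmx (cD0 0 0) (cD0 1 0)).
have cdA : continuous dA.
  exact: continuous_submx (continuous_submx
    (continuous_addmx (continuous_mulmx (cD0 1 1) (cD0 0 0))
      (continuous_mulmx (cD0 1 0) (cD0 0 1)))
    (continuous_mulmx (cD0 0 1) (cD0 1 0))) (continuous_mulmx (cD0 0 0) (cD0 1 1)).
have cdO : continuous dOt.
  exact: continuous_submx (continuous_mulmx cOt cOT) (continuous_mulmx cOT cOt).
have cphi : continuous phi := continuous_frob cOt cA.
have cdphi : continuous dphi.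
  move=> t; apply: cvgD; first exact: (continuous_frob cdO cA).
  exact: (continuous_frob cOt cdA).
have phi_ends t : t = a \/ t = b -> phi t = 0.
  move=> /D_s_end e0; rewrite /phi /A e0 mul0mx mulmx0 subr0.
  by rewrite /frob mulmx0 mxtrace0.
transitivity (\int[mu]_(t in `[a, b]) dphi t).
  apply: eq_Rintegral => t; rewrite inE /= in_itv /= => tab.
  exact: frob_dL_start.
rewrite /Rintegral (@continuous_FTC2 _ dphi phi) //.
- by rewrite (phi_ends a) ?(phi_ends b) ?subee //; [right|left].
- exact: continuous_subspaceT.
- split=> [t _||].
  + by have [] := is_derive_frob_A t.
  + exact/cvg_at_right_filter/cphi.
  + exact/cvg_at_left_filter/cphi.
- move=> t _; rewrite derive1E; have d := is_derive_frob_A t.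
  by rewrite derive_val.
Qed.

Lemma energy_critical :
  is_derive (0 : R) (1 : R) (fun s => energy (gSpGr k) a b (F s)) 0.
Proof.
have ab' := ltW ab.
have dhiE : \int[mu]_(t in `[a, b]) dhi 0 t = 0.
  rewrite -[RHS]integral_dL_start; apply: eq_Rintegral => t.
  rewrite inE /= in_itv /= => tab; rewrite /dhi L_start // (frobC (dL 0 t)).
  lra.
have dloE : \int[mu]_(t in `[a, b]) dlo 0 t = 0.
  rewrite -[RHS]integral_dL_start; apply: eq_Rintegral => t.
  rewrite inE /= in_itv /= => tab; rewrite /dlo L_start // B_start //.
  rewrite (frobC (dB 0 t)); lra.
have dH := is_derive_integral ab' continuous_hi continuous_dhi is_derive_hi.
have dK := is_derive_integral ab' continuous_lo continuous_dlo is_derive_lo.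
rewrite dhiE in dH; rewrite dloE in dK.
have dHZ := is_deriveZ 2^-1 dH; have dKZ := is_deriveZ 2^-1 dK.
rewrite scaler0 in dHZ dKZ.
apply: (is_derive_squeeze e_gt0 _ _ dKZ dHZ) => [s se|].
  have slice (f : R -> R -> R) : continuous (fun p : R * R => f p.1 p.2) ->
      continuous (f s) by exact: continuous_slice.
  have gE t : gSpGr k (F s t) ((F s)^`() t)%classic ((F s)^`() t)%classic = g s t.
    by rewrite derive1E; have d := D_dt 0 0 s t; rewrite derive_val.
  have := Rintegral_squeeze (slice _ continuous_lo) (slice _ continuous_hi)
    (fun t tab => g_ge0 se tab) (fun t tab => g_bounds se tab).
  rewrite /energy; under [in X in _ -> X]eq_Rintegral do rewrite gE.
  by move=> /andP[h1 h2]; rewrite !ler_pM2l ?invr_gt0 // h1 h2.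
congr (_ * _); apply: eq_Rintegral => t; rewrite inE /= in_itv /= => tab.
rewrite /lo /hi L_start // B_start //; lra.
Qed.

End WithVariation.

(** The hypothesis on [O'] is the Euler-Arnold equation of the invariant metric, for
    a curve of projectors that is moved by the horizontal matrices [O]. *)
Lemma geodesic_of_horizontal_flow : smooth gamma ->
  geodesic (SpGr k) (gSpGr k) gamma.
Proof.
move=> sgamma; split=> // a b e F ab e0 [[D [DF D_smooth]] FM F0 Fab].
subst F.
by apply: (@energy_critical a b e D) => //; move=> i j; have [] := D_smooth i j.
Qed.

End FirstVariation.

(** * Smooth curves *)

Section Smooth.
Context {R : realType}.

(** Smoothness by coinduction: it suffices to exhibit a class of differentiable
    curves that is closed under differentiation. *)
Lemma smooth_coind (V : normedModType R) (S : set (R -> V)) :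
  (forall f, S f -> exists2 f', S f' & forall t, is_derive t (1 : R) f (f' t)) ->
  forall f, S f -> smooth f.
Proof.
move=> dS f Sf.
have Sn m : S (f^`(m))%classic.
  elim: m => [|m IHm]; first by rewrite derive1n0.
  have [f' Sf' df'] := dS _ IHm.
  rewrite derive1nS (_ : _^`()%classic = f') //.
  by apply/funext => t; rewrite derive1E; have d := df' t; rewrite derive_val.
by move=> m t; have [f' _ df'] := dS _ (Sn m); have [] := df' t.
Qed.

Lemma smooth_is_derive (V : normedModType R) (f : R -> V) m t : smooth f ->
  is_derive t (1 : R) (f^`(m))%classic ((f^`(m.+1))%classic t).
Proof.
by move=> sf; apply: DeriveDef; [exact: sf|rewrite derive1nS derive1E].
Qed.

(** By the product rule this class of curves is closed under differentiation. *)
Inductive leibniz_sum m n p (f : R -> 'M[R]_(m, n)) (g : R -> 'M[R]_(n, p)) :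
    (R -> 'M[R]_(m, p)) -> Prop :=
  | leibniz_mul i j :
      leibniz_sum f g (fun t => (f^`(i))%classic t *m (g^`(j))%classic t)
  | leibniz_add h1 h2 : leibniz_sum f g h1 -> leibniz_sum f g h2 ->
      leibniz_sum f g (fun t => h1 t + h2 t).

Lemma smooth_mulmx m n p (f : R -> 'M[R]_(m, n)) (g : R -> 'M[R]_(n, p)) :
  smooth f -> smooth g -> smooth (fun t => f t *m g t).
Proof.
move=> sf sg; apply: (@smooth_coind _ (leibniz_sum f g)); last first.
  exact: (leibniz_mul f g 0 0).
move=> h; elim=> [i j|h1 h2 _ [h1' S1 d1] _ [h2' S2 d2]]; last first.
  exists (fun t => h1' t + h2' t); first exact: leibniz_add.
  by move=> t; exact: is_deriveD (d1 t) (d2 t).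
exists (fun t => (f^`(i.+1))%classic t *m (g^`(j))%classic t +
                 (f^`(i))%classic t *m (g^`(j.+1))%classic t).
  by apply: leibniz_add; exact: leibniz_mul.
by move=> t; exact: is_derive_mulmx (smooth_is_derive i t sf) (smooth_is_derive j t sg).
Qed.

Lemma smooth_sadj a b (f : R -> 'M[R]_(a + a, b + b)) :
  smooth f -> smooth (fun t => sadj (f t)).
Proof.
move=> sf.
apply: (@smooth_coind _ [set h | exists i, h = fun t => sadj ((f^`(i))%classic t)]).
  move=> _ [i ->]; exists (fun t => sadj ((f^`(i.+1))%classic t)).
    by exists i.+1.
  by move=> t; exact: is_derive_sadj (smooth_is_derive i t sf).
by exists 0.
Qed.

Lemma smooth_mexp m p (A B : 'M[R]_m) (X : 'M[R]_(m, p)) :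
  smooth (fun t => mexp (t *: A) *m mexp (t *: B) *m X).
Proof.
pose S : set (R -> 'M[R]_(m, p)) :=
  [set h | exists Q, h = fun t => mexp (t *: A) *m Q *m mexp (t *: B) *m X].
apply: (@smooth_coind _ S); last first.
  by exists 1%:M; apply/funext => t; rewrite mulmx1.
move=> _ [Q ->].
exists (fun t => mexp (t *: A) *m (A *m Q + Q *m B) *m mexp (t *: B) *m X).
  by exists (A *m Q + Q *m B).
move=> t; apply: is_derive_mulmxr.
have dA := is_derive_mulmxr Q (is_derive_mexp A t).
apply: is_derive_eq (is_derive_mulmx dA (is_derive_mexp B t)) _.
by rewrite mulmxDr mulmxDl !mulmxA mexpZC.
Qed.

End Smooth.

(** * The geodesic *)

Section Flow.
Context {R : realType} {n k : nat}.
Variables (U : 'M[R]_(n + n, k + k)) (W A : 'M[R]_(n + n)).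
Hypothesis U_SpSt : SpSt U.
Hypothesis W_hor : horizontal (rho U) W.
Hypothesis WA : W - W^T = A.

Let c t := mexp (t *: A) *m mexp (t *: W^T) *m U.
Let O t := mexp (t *: A) *m W *m mexp (t *: - A).

Let hamW : hamiltonian W. Proof. by case: W_hor. Qed.

Let hamA : hamiltonian A.
Proof. by rewrite -WA; exact/hamiltonianD/hamiltonianN/hamiltonian_trmx. Qed.

Let trmx_A : A^T = - A.
Proof. by rewrite -WA linearB /= trmxK opprB. Qed.

Lemma sadj_mexp_hamiltonian (B : 'M[R]_(n + n)) t :
  hamiltonian B -> sadj (mexp (t *: B)) = mexp (t *: - B).
Proof. by move=> hB; rewrite sadj_mexp sadjZ hB. Qed.

Lemma mexpNZ' m (B : 'M[R]_m) t : mexp (t *: - B) *m mexp (t *: B) = 1%:M.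
Proof. by have := mexpNZ (- B) t; rewrite opprK. Qed.

(* This and the next three local facts are stated for arbitrary matrices [E], [E'],
   [F], [F'] with the algebraic relations of the exponentials of [t A], [- t A],
   [t W^T] and [- t W^T]. *)
Let SpSt_mul (E E' : 'M[R]_(n + n)) (V : 'M[R]_(n + n, k + k)) :
  sadj E = E' -> E' *m E = 1%:M -> SpSt V -> SpSt (E *m V).
Proof.
move=> sE EE VSp; rewrite /SpSt /= (sadjM E) sE !mulmxA -(mulmxA _ E') EE mulmx1.
exact: VSp.
Qed.

Lemma flow_SpSt t : SpSt (c t).
Proof.
have hWT := hamiltonian_trmx hamW.
rewrite /c -mulmxA.
apply: SpSt_mul (sadj_mexp_hamiltonian t hamA) (mexpNZ' A t) _.
exact: SpSt_mul (sadj_mexp_hamiltonian t hWT) (mexpNZ' W^T t) U_SpSt.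
Qed.

Let velocity_mul (E E' F : 'M[R]_(n + n)) :
  A *m E = E *m A -> E' *m E = 1%:M ->
  (A *m E *m F + E *m (W^T *m F)) *m U = E *m W *m E' *m (E *m F *m U).
Proof.
move=> AE EE; rewrite !mulmxA -(mulmxA _ E') EE mulmx1 AE -mulmxDl -mulmxDr.
by rewrite -WA subrK.
Qed.

Lemma is_derive_flow t : is_derive t (1 : R) c (O t *m c t).
Proof.
have d := is_derive_mulmx (is_derive_mexp A t) (is_derive_mexp W^T t).
apply: is_derive_eq (is_derive_mulmxr U d) _.
exact: velocity_mul (mexpZC A t) (mexpNZ' A t).
Qed.

Let trmx_conj (E E' : 'M[R]_(n + n)) :
  E^T = E' -> E'^T = E -> (E *m W *m E')^T = E *m W^T *m E'.
Proof. by move=> tE tE'; rewrite !trmx_mul tE tE' mulmxA. Qed.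

Let trmx_mexpZA t : (mexp (t *: A))^T = mexp (t *: - A).
Proof. by rewrite trmx_mexp linearZ /= trmx_A. Qed.

Let trmx_mexpZNA t : (mexp (t *: - A))^T = mexp (t *: A).
Proof. by rewrite -trmx_mexpZA trmxK. Qed.

Lemma trmx_flow_velocity t :
  (O t)^T = mexp (t *: A) *m W^T *m mexp (t *: - A).
Proof. exact: trmx_conj (trmx_mexpZA t) (trmx_mexpZNA t). Qed.

Lemma flow_difference t : O t - (O t)^T = A.
Proof.
rewrite trmx_flow_velocity /O -mulmxBl -mulmxBr WA.
have conjA (E E' : 'M[R]_(n + n)) :
    A *m E = E *m A -> E *m E' = 1%:M -> E *m A *m E' = A.
  by move=> <- EE; rewrite -mulmxA EE mulmx1.
exact: conjA (mexpZC A t) (mexpNZ A t).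
Qed.

(** Conjugation by the orthogonal symplectic matrix [E] preserves horizontality;
    conjugation by [F], which commutes with the transpose of [W], leaves the
    equation of [W] unchanged. *)
Let horizontal_conj (E E' F F' : 'M[R]_(n + n)) :
  sadj E = E' -> sadj E' = E -> sadj F = F' -> E' *m E = 1%:M ->
  F' *m F = 1%:M -> F *m F' = 1%:M -> W^T *m F = F *m W^T ->
  E^T = E' -> E'^T = E ->
  horizontal (rho (E *m F *m U)) (E *m W *m E').
Proof.
move=> sE sE' sF EE FF FF' WF tE tE'; have [_ WP] := W_hor; split.
  rewrite /hamiltonian (sadjM _ E') (sadjM E) sE sE' hamW.
  by rewrite mulNmx mulmxN mulmxA.
have WF' : W^T *m F' = F' *m W^T.
  by rewrite -[W^T in LHS]mul1mx -FF -(mulmxA F') -WF !mulmxA -(mulmxA _ F) FF' mulmx1.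
have rhoE : rho (E *m F *m U) = E *m (F *m rho U *m F') *m E'.
  by rewrite /rho (sadjM _ U) (sadjM E) sE sF !mulmxA.
rewrite rhoE trmx_conj //; move: WP; move: (rho U) => P WP.
have WFP : W^T = F *m P *m F' *m W^T + W^T *m (F *m P *m F').
  rewrite -{1}[W^T]mul1mx -FF' -mulmxA -WF' {1}WP mulmxDl mulmxDr !mulmxA.
  by rewrite -(mulmxA _ W^T F') WF' !mulmxA WF.
rewrite {1}WFP mulmxDr mulmxDl !mulmxA; congr (_ + _).
  by rewrite -(mulmxA _ E' E) EE mulmx1.
by rewrite -(mulmxA _ E' E) EE mulmx1.
Qed.

Lemma horizontal_flow t : horizontal (rho (c t)) (O t).
Proof.
have hWT := hamiltonian_trmx hamW; have hNA := hamiltonianN hamA.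
apply: (@horizontal_conj _ _ _ (mexp (t *: - W^T))).
- exact: sadj_mexp_hamiltonian.
- by rewrite sadj_mexp_hamiltonian // opprK.
- exact: sadj_mexp_hamiltonian.
- exact: mexpNZ'.
- exact: mexpNZ'.
- exact: mexpNZ.
- exact: mexpZC.
- exact: trmx_mexpZA.
- exact: trmx_mexpZNA.
Qed.

Lemma is_derive_flow_velocity t :
  is_derive t (1 : R) O (O t *m (O t)^T - (O t)^T *m O t).
Proof.
have d := is_derive_mulmx (is_derive_mulmxr W (is_derive_mexp A t))
  (is_derive_mexp (- A) t).
apply: is_derive_eq d _.
have OT : (O t)^T = O t - A.
  have subl (X Y Z : 'M[R]_(n + n)) : X - Y = Z -> Y = X - Z.
    by move=> <-; rewrite subKr.
  exact: subl (flow_difference t).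
have conjA (E E' : 'M[R]_(n + n)) : A *m E' = E' *m A ->
    A *m E *m W *m E' + E *m W *m (- A *m E') =
    E *m W *m E' *m (E *m W *m E' - A) - (E *m W *m E' - A) *m (E *m W *m E').
  by move=> AE; mxexp; rewrite -[in X in _ - X]mulmxA AE; mxexp; mxlin.
rewrite OT; apply: conjA.
by apply/esym/mexpZ_intertwine; rewrite mulmxN mulNmx.
Qed.

End Flow.

Lemma is_derive_rho_comp {R : realType} {n k : nat}
    (c : R -> 'M[R]_(n + n, k + k)) (O : 'M[R]_(n + n)) t :
  hamiltonian O -> is_derive t (1 : R) c (O *m c t) ->
  is_derive t (1 : R) (fun t => rho (c t)) (O *m rho (c t) - rho (c t) *m O).
Proof.
move=> hO dc; apply: is_derive_eq (is_derive_mulmx dc (is_derive_sadj dc)) _.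
by rewrite sadjM hO /rho !mulmxN !mulmxA.
Qed.

Lemma skew_factor {R : realType} {n k : nat} (U H : 'M[R]_(n + n, k + k))
    (W : 'M[R]_(n + n)) (JHJ := (Jmx n)^T *m H *m Jmx k)
    (JUJ := (Jmx n)^T *m U *m Jmx k) :
  W^T = U *m sadj H - H *m sadj U ->
  W - W^T = row_mx (row_mx JHJ (- JUJ)) (row_mx (- U) H) *m
            (row_mx (row_mx U H) (row_mx JHJ JUJ))^T.
Proof.
move=> WT.
have sadj_tr (V : 'M[R]_(n + n, k + k)) :
    ((Jmx n)^T *m V *m Jmx k)^T = sadj V.
  by rewrite !trmx_mul trmxK mulmxA.
have trmx_sadj (V : 'M[R]_(n + n, k + k)) :
    (sadj V)^T = (Jmx n)^T *m V *m Jmx k by rewrite -sadj_tr trmxK.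
have WE : W = JHJ *m U^T - JUJ *m H^T.
  by rewrite -[LHS]trmxK WT [(_ - _)^T]linearB /= (trmx_mul U) (trmx_mul H) !trmx_sadj.
rewrite WT {1}WE !tr_row_mx !mul_row_col !sadj_tr !mulNmx.
by mxlin.
Qed.

Section LiftedGeodesic.
Context {R : realType} {n k : nat}.
Variables U D : 'M[R]_(n + n, k + k).
Hypothesis U_SpSt : SpSt U.
Hypothesis D_hor : horSpSt U D.

Local Notation J := (Jmx n).
Local Notation P := (rho U).
Local Notation W := (Omegabar U D).

Let W_hor : horizontal P W.
Proof. exact: horizontal_Omegabar. Qed.

Let dc t := is_derive_flow U (erefl (W - W^T)) t.

Lemma ExpSpGr_velocity t : ((ExpSpGr U D)^`() t)%classic =
  mexp (t *: (W - W^T)) *m W *m mexp (t *: - (W - W^T)) *m ExpSpGr U D t.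
Proof. by rewrite derive1E; have d := dc t; exact: derive_val. Qed.

Lemma ExpSpGr0 : ExpSpGr U D 0 = U.
Proof. by rewrite /ExpSpGr /= !scale0r !mexp0 !mul1mx. Qed.

Lemma lifted_geodesic_ExpSpGr : lifted_geodesic U D (ExpSpGr U D).
Proof.
have cSp t : SpSt (ExpSpGr U D t) := flow_SpSt U_SpSt W_hor erefl t.
have hO := horizontal_flow W_hor (erefl (W - W^T)).
have dgamma t : is_derive t (1 : R) (fun t => rho (ExpSpGr U D t))
    (mexp (t *: (W - W^T)) *m W *m mexp (t *: - (W - W^T)) *m rho (ExpSpGr U D t) -
     rho (ExpSpGr U D t) *m (mexp (t *: (W - W^T)) *m W *m mexp (t *: - (W - W^T)))).
  by have [hamO _] := hO t; exact: is_derive_rho_comp hamO (dc t).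
have sc : smooth (ExpSpGr U D) := @smooth_mexp _ _ _ (W - W^T) W^T U.
split.
- by split.
- move=> t; rewrite ExpSpGr_velocity; apply: horizontal_horSpSt => //.
  exact: hO.
- split; first exact: ExpSpGr0.
  by rewrite ExpSpGr_velocity ExpSpGr0 !scale0r !mexp0 mul1mx mulmx1 Omegabar_mul.
- apply: geodesic_of_horizontal_flow dgamma _ _.
  + by move=> t; exact: SpGr_rho.
  + exact: hO.
  + exact: is_derive_flow_velocity.
  + exact: smooth_mulmx sc (smooth_sadj sc).
- split; first by rewrite /= ExpSpGr0.
  rewrite derive1E; have d := dgamma 0; rewrite (@derive_val _ _ _ _ _ _ _ d).
  rewrite ExpSpGr0 !scale0r !mexp0 mul1mx mulmx1.
  have [hamW _] := W_hor.
  by rewrite -(derive_rho_mul _ hamW) Omegabar_mul.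
Qed.

Local Notation G := (invmx (U^T *m U)).
Variable H : 'M[R]_(n + n, k + k).
Hypothesis HE : H = (1%:M - U *m sadj U) *m J^T *m D *m G *m Jmx k.

(** [P W^T U = 0] by horizontality, so only the kernel component of [W^T U] is left;
    in the expansion of [W^T] it comes from a single term. *)
Lemma trmx_Omegabar_mul : W^T *m U = - H.
Proof.
have PWU : P *m W^T *m U = 0.
  transitivity (P *m W^T *m P *m U); first by rewrite -[RHS]mulmxA rho_mul.
  by rewrite (horizontal_block (rho_idem U_SpSt) W_hor) mul0mx.
have -> : W^T *m U = (1%:M - P) *m (W^T *m U).
  by rewrite mulmxBl mul1mx mulmxA PWU subr0.
have QU : (1%:M - P) *m U = 0 by rewrite mulmxBl mul1mx rho_mul // subrr.
have UJU : U^T *m J^T *m U = - Jmx k.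
  by rewrite trmx_Jmx mulmxN mulNmx trmx_mul_Jmx -mulmxA SpSt_sadj_mul // mulmx1.
rewrite HE -/P; move: (1%:M - P) QU => Q QU.
rewrite OmegabarE [(_ + _)^T]linearD /= !trmx_mul !trmxK trmx_gram_inv.
rewrite [(1%:M - _)^T]linearB /= trmx1 trmx_Pi.
rewrite mulmxDl mulmxDr !mulmxA QU !mul0mx add0r mulmxBr mulmx1 !mulmxA QU.
rewrite !mul0mx subr0 -!(mulmxA (Q *m J^T *m D *m G)) UJU.
by rewrite mulmxN.
Qed.

(** By horizontality [W^T = P W^T + W^T P]; the second term is known on [U], and the
    first is determined by it because [W] is Hamiltonian. *)
Lemma trmx_OmegabarE : W^T = U *m sadj H - H *m sadj U.
Proof.
have [hamW WT] := W_hor.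
have WP : W^T *m P = - (H *m sadj U).
  by rewrite /rho mulmxA trmx_Omegabar_mul mulNmx.
have PW : P *m W^T = U *m sadj H.
  have : sadj (W^T *m P) = - (P *m W^T).
    by rewrite sadjM sadj_rho sadj_trmx hamW linearN mulmxN.
  by rewrite WP sadjN sadjM sadjK => /eqP; rewrite eqr_opp => /eqP.
by rewrite WT PW WP.
Qed.

Let X : 'M[R]_(n + n, ((k + k) + (k + k)) + ((k + k) + (k + k))) :=
  row_mx (row_mx (J^T *m H *m Jmx k) (- (J^T *m U *m Jmx k))) (row_mx (- U) H).
Let Y : 'M[R]_(n + n, ((k + k) + (k + k)) + ((k + k) + (k + k))) :=
  row_mx (row_mx U H) (row_mx (J^T *m H *m Jmx k) (J^T *m U *m Jmx k)).

Lemma Omegabar_skew_factor : W - W^T = X *m Y^T.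
Proof.
exact: skew_factor trmx_OmegabarE.
Qed.

Lemma Omegabar_trmx_block : W^T *m row_mx (- U) H =
  row_mx (- U) H *m block_mx 0 (- (sadj H *m H)) 1%:M 0.
Proof.
have UH : sadj U *m H = 0.
  rewrite HE !mulmxA mulmxBr mulmx1 !mulmxA SpSt_sadj_mul // mul1mx subrr.
  by rewrite !mul0mx.
rewrite mul_mx_row mul_row_block mulmxN trmx_Omegabar_mul opprK.
rewrite !mulmx0 mulmx1 addr0 add0r mulNmx mulmxN opprK.
rewrite trmx_OmegabarE mulmxBl -(mulmxA H (sadj U)) UH mulmx0 subr0.
by rewrite -(mulmxA U (sadj H)).
Qed.

Lemma ExpSpGr_factorization t : ExpSpGr U D t =
  X *m mexp (t *: (Y^T *m X)) *m col_mx 0 (- 1%:M)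
    *m mexp (t *: block_mx 0 (- (sadj H *m H)) 1%:M 0) *m col_mx 1%:M 0.
Proof.
have XZ : X *m col_mx 0 (- 1%:M) = - row_mx (- U) H.
  by rewrite mul_row_col mulmx0 add0r mulmxN mulmx1.
have UZ : U = - row_mx (- U) H *m col_mx 1%:M 0.
  by rewrite mulNmx mul_row_col mulmx1 mulmx0 addr0 opprK.
have XE : mexp (t *: (W - W^T)) *m X = X *m mexp (t *: (Y^T *m X)).
  by apply: mexpZ_intertwine; rewrite Omegabar_skew_factor -mulmxA.
have ZE := mexpZ_intertwine t Omegabar_trmx_block.
rewrite /ExpSpGr /= -XE; move: ZE XZ UZ; rewrite -/X.
move: (mexp _) (mexp _) (mexp _) => E F B ZE XZ UZ.
rewrite {1}UZ -(mulmxA E X) XZ !(mulmxN, mulNmx) -(mulmxA E _ F) -ZE.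
by rewrite !mulmxA.
Qed.

End LiftedGeodesic.

Theorem proposition4p10 (R : realType) (n k : nat)
    (k_gt0 : (0 < k)%N) (le_kn : (k <= n)%N)
    (U D : 'M[R]_(n + n, k + k))
    (U_SpSt : SpSt U) (D_hor : horSpSt U D) :
  let H : 'M[R]_(n + n, k + k) :=
    (1%:M - U *m sadj U) *m (Jmx n)^T *m D *m invmx (U^T *m U) *m Jmx k in
  let X : 'M[R]_(n + n, ((k + k) + (k + k)) + ((k + k) + (k + k))) :=
    row_mx (row_mx ((Jmx n)^T *m H *m Jmx k) (- ((Jmx n)^T *m U *m Jmx k)))
           (row_mx (- U) H) in
  let Y : 'M[R]_(n + n, ((k + k) + (k + k)) + ((k + k) + (k + k))) :=
    row_mx (row_mx U H)
           (row_mx ((Jmx n)^T *m H *m Jmx k) ((Jmx n)^T *m U *m Jmx k)) in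
  lifted_geodesic U D (ExpSpGr U D) /\
  forall t : R,
    ExpSpGr U D t =
      X *m mexp (t *: (Y^T *m X))
        *m col_mx 0 (- 1%:M)
        *m mexp (t *: block_mx 0 (- (sadj H *m H)) 1%:M 0)
        *m col_mx 1%:M 0.
Proof.
move=> H X Y; split; first exact: lifted_geodesic_ExpSpGr.
move=> t; exact: (@ExpSpGr_factorization _ _ _ U D U_SpSt D_hor H erefl t).
Qed.
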